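(* Let $\alpha,\beta>-1$ and $n\in\mathbb{N}_0$. Let $\tilde P_n^{(\alpha,\beta)}$ be the orthonormal Jacobi polynomials, and let $$I_n^{(J_\alpha)}(\alpha,\beta)=4\int_{-1}^1\left\{\frac{\partial}{\partial\alpha}\Big([(1-x)^\alpha(1+x)^\beta]^{1/2}\tilde P_n^{(\alpha,\beta)}(x)\Big)\right\}^2dx,$$ $$I_n^{(J_\beta)}(\alpha,\beta)=4\int_{-1}^1\left\{\frac{\partial}{\partial\beta}\Big([(1-x)^\alpha(1+x)^\beta]^{1/2}\tilde P_n^{(\alpha,\beta)}(x)\Big)\right\}^2dx$$ be the Fisher informations with respect to the first and second parameter. Then $$I_n^{(J_\alpha)}(\alpha,\beta)=2\sum_{k=0}^{n-1}\big[\tilde A_k^{(J_\alpha)}\big]^2-2\frac{\partial\tilde A_n^{(J_\alpha)}}{\partial\alpha}$$ $$=2\frac{\Gamma(n+\beta+1)\,n!\,(2n+\alpha+\beta+1)}{\Gamma(n+\alpha+1)\Gamma(n+\alpha+\beta+1)}\sum_{k=0}^{n-1}\frac{\Gamma(k+\alpha+1)\Gamma(k+\alpha+\beta+1)(2k+\alpha+\beta+1)}{\Gamma(k+\beta+1)\,k!\,(n-k)^2(n+k+\alpha+\beta+1)^2}$$ $$-2\psi^{(1)}(2n+\alpha+\beta+1)+\psi^{(1)}(n+\alpha+\beta+1)+\psi^{(1)}(n+\alpha+1)+\frac{1}{(2n+\alpha+\beta+1)^2},$$ and $$I_n^{(J_\beta)}(\alpha,\beta)=2\sum_{k=0}^{n-1}\big[\tilde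 A_k^{(J_\beta)}\big]^2-2\frac{\partial\tilde A_n^{(J_\beta)}}{\partial\beta}$$ $$=2\frac{\Gamma(n+\alpha+1)\,n!\,(2n+\alpha+\beta+1)}{\Gamma(n+\beta+1)\Gamma(n+\alpha+\beta+1)}\sum_{k=0}^{n-1}\frac{\Gamma(k+\beta+1)\Gamma(k+\alpha+\beta+1)(2k+\alpha+\beta+1)}{\Gamma(k+\alpha+1)\,k!\,(n-k)^2(n+k+\alpha+\beta+1)^2}$$ $$-2\psi^{(1)}(2n+\alpha+\beta+1)+\psi^{(1)}(n+\alpha+\beta+1)+\psi^{(1)}(n+\beta+1)+\frac{1}{(2n+\alpha+\beta+1)^2}.$$ When $\alpha+\beta+1=0$, the formally indeterminate expressions are understood by continuity (e.g. $\Gamma(\alpha+\beta+1)(\alpha+\beta+1)=\Gamma(\alpha+\beta+2)$ in the $k=0$ term).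
   Context: $\tilde P_n^{(\alpha,\beta)}=P_n^{(\alpha,\beta)}/d_n$, where $P_n^{(\alpha,\beta)}$ are the standard Jacobi polynomials and $d_n^2=\frac{2^{\alpha+\beta+1}\Gamma(n+\alpha+1)\Gamma(n+\beta+1)}{n!(2n+\alpha+\beta+1)\Gamma(n+\alpha+\beta+1)}$, $d_n>0$, so that $\int_{-1}^1\tilde P_n^{(\alpha,\beta)}\tilde P_m^{(\alpha,\beta)}(1-x)^\alpha(1+x)^\beta dx=\delta_{nm}$. The numbers $\tilde A_k^{(J_\alpha)}$ and $\tilde A_k^{(J_\beta)}$ ($0\le k\le n$) are the coefficients in $\frac{\partial}{\partial\alpha}\tilde P_n^{(\alpha,\beta)}=\sum_{k=0}^n\tilde A_k^{(J_\alpha)}\tilde P_k^{(\alpha,\beta)}$ and $\frac{\partial}{\partial\beta}\tilde P_n^{(\alpha,\beta)}=\sum_{k=0}^n\tilde A_k^{(J_\beta)}\tilde P_k^{(\alpha,\beta)}$. $\psi^{(1)}(x)=\frac{d^2}{dx^2}\ln\Gamma(x)$ is the trigamma function. *)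

(* Defs.v *)
From HB Require Import structures.
From mathcomp Require Import all_boot all_order all_algebra.
From mathcomp Require Import all_classical all_reals all_analysis.

Set Implicit Arguments.
Unset Strict Implicit.
Unset Printing Implicit Defensive.

Import Order.TTheory GRing.Theory Num.Theory.
Import numFieldNormedType.Exports.

Local Open Scope classical_set_scope.
Local Open Scope ring_scope.

Definition pochhammer (R : realType) (x : R) (k : nat) : R :=
  \prod_(i < k) (x + i%:R).

Definition euler_integral (R : realType) (x : R) : R :=
  \int[@lebesgue_measure R]_(t in `]0, +oo[) (t `^ (x - 1) * expR (- t)).

(* For x <= 0 the exponent m is the least natural number with 0 < x + m, and
   Gamma (x + m) = x (x + 1) ... (x + m - 1) Gamma x extends Gamma to the
   negative non-integers. At the poles 0, -1, -2, ... the value is the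
   meaningless y / 0 = 0. *)
Definition Gamma (R : realType) (x : R) : R :=
  if 0 < x then euler_integral x
  else let m := (Num.truncn (- x)).+1 in
       euler_integral (x + m%:R) / pochhammer x m.

(* The absolute value only matters for x < 0: it selects the real part of the
   complex logarithm of Gamma, whose imaginary part is locally constant. *)
Definition trigamma (R : realType) (x : R) : R :=
  derive1n 2 (fun y : R => ln `|Gamma y|) x.

(* Value of f at s, read as a limit when the expression f s is indeterminate. *)
Definition by_continuity (R : realType) (indeterminate : bool) (f : R -> R)
    (s : R) : R :=
  if indeterminate then lim (f t @[t --> s^']) else f s.

(* Here s stands for alpha + beta + 1 > -1, so that k + s = 0 means
   k = 0 and s = 0. *)
Definition Gamma_mul (R : realType) (k : nat) (s : R) : R :=
  by_continuity (k%:R + s == 0)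
    (fun t => Gamma (k%:R + t) * (2 * k%:R + t)) s.

(* The terms of the closed form of the Fisher informations that are separately
   singular for n = 0 and s = 0. *)
Definition trigamma_part (R : realType) (n : nat) (s : R) : R :=
  by_continuity (n%:R + s == 0)
    (fun t => - 2 * trigamma (2 * n%:R + t) + trigamma (n%:R + t)
              + 1 / (2 * n%:R + t) ^+ 2) s.

(* P_n^(a,b)(x)
     = (a + 1)_n / n! * 2F1(- n, n + a + b + 1; a + 1; (1 - x) / 2),
   with the denominators (a + 1)_l cleared so that it makes sense for all real
   a and b. *)
Definition jacobi (R : realType) (n : nat) (a b x : R) : R :=
  \sum_(l < n.+1)
    pochhammer (n%:R + a + b + 1) l * pochhammer (a + l%:R + 1) (n - l)
    / (l`!%:R * (n - l)`!%:R) * ((x - 1) / 2) ^+ l.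

Definition jacobi_norm (R : realType) (n : nat) (a b : R) : R :=
  Num.sqrt (2 `^ (a + b + 1) * Gamma (n%:R + a + 1) * Gamma (n%:R + b + 1)
            / (n`!%:R * Gamma_mul n (a + b + 1))).

Definition ojacobi (R : realType) (n : nat) (a b x : R) : R :=
  jacobi n a b x / jacobi_norm n a b.

Definition jacobi_weight (R : realType) (a b x : R) : R :=
  (1 - x) `^ a * (1 + x) `^ b.

(* The k-th coefficient (k <= n) in the expansion of f in the orthonormal
   Jacobi polynomials of degree at most n with parameters a and b. *)
Definition ojacobi_coef (R : realType) (n : nat) (a b : R) (f : R -> R)
    (k : nat) : R :=
  xget (0 : 'rV[R]_n.+1)
    [set A : 'rV[R]_n.+1 |
      forall x : R, f x = \sum_(j < n.+1) A 0 j * ojacobi j a b x] 0 (inord k).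

Definition coefA_alpha (R : realType) (n k : nat) (a b : R) : R :=
  ojacobi_coef n a b (fun x => derive1 (fun a' : R => ojacobi n a' b x) a) k.

Definition coefA_beta (R : realType) (n k : nat) (a b : R) : R :=
  ojacobi_coef n a b (fun x => derive1 (fun b' : R => ojacobi n a b' x) b) k.

Definition fisher_alpha (R : realType) (n : nat) (a b : R) : \bar R :=
  (4%:E * \int[@lebesgue_measure R]_(x in `](-1)%R, 1%R[)
     ((derive1 (fun a' : R =>
         Num.sqrt (jacobi_weight a' b x) * ojacobi n a' b x) a ^+ 2)%R)%:E)%E.

Definition fisher_beta (R : realType) (n : nat) (a b : R) : \bar R :=
  (4%:E * \int[@lebesgue_measure R]_(x in `](-1)%R, 1%R[)
     ((derive1 (fun b' : R =>
         Num.sqrt (jacobi_weight a b' x) * ojacobi n a b' x) b ^+ 2)%R)%:E)%E.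

(* Main.v *)
(* Write w for the weight, P_k for the orthonormal polynomials, D for the
   derivative in alpha and L = ln (1 - x) = D w / w.  The integrand of the Fisher
   information is w (L P_n / 2 + D P_n)^2.  Differentiating the orthonormality
   relations gives
     int w L P_n P_k = - A_k (k < n)   and   int w L P_n^2 = - 2 A_n,
   and differentiating the last identity once more gives
     int w L^2 P_n^2 + 2 int w L P_n D P_n = - 2 D A_n.
   Expanding D P_n in the P_k then yields the first formula.

   For the closed form, D commutes with the Jacobi differential equation up to
   (1 + x) P' - n P, which is a multiple of P_{n-1}^(alpha+1, beta) and hence, by a
   contiguous relation, an explicit combination of the P_k; dividing by the
   differences of eigenvalues gives A_k for k < n, and A_n is read off the leading
   coefficient.  The second parameter reduces to the first one by x -> - x.

   On the analytic side, both the gamma integral and the integrals against w are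
   of the form int h exp (a phi), which can be differentiated under the integral
   sign and is log-convex in a.  The beta-gamma relation follows: the quotient of
   its two sides is 1-periodic in a, and log-convexity forces its logarithmic
   derivative to tend to 0 at infinity. *)
Require Import Defs.
From HB Require Import structures.
From mathcomp Require Import all_boot all_order all_algebra.
From mathcomp Require Import all_classical all_reals all_analysis.
From mathcomp Require Import measurable_realfun.
From mathcomp Require Import zify ring lra.

Set Implicit Arguments.
Unset Strict Implicit.
Unset Printing Implicit Defensive.

Import Order.TTheory GRing.Theory Num.Theory.
Import numFieldNormedType.Exports.

Local Open Scope classical_set_scope.
Local Open Scope ring_scope.

(** * Parametric exponential integrals *)

(** The delicate range is n = 0 with s = alpha + beta + 1 in (-1, 0], where Γ(s) is negative or at
    its pole. Norms, leading coefficients and connection coefficients are therefore all written with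
    [Gamma_mul n s], which is positive for every s > -1. They can be inverted, and their logarithms
    differentiated in alpha, without singling out s = 0; the limits are resolved once, in
    [Gamma_mulE] and [trigamma_partE]. Orthogonality and norms use no Rodrigues formula. One
    integration by parts ([jacobi_integral_pearson]) makes the Jacobi operator symmetric, and its
    energy form ties the norm in degree n + 1 with parameters (a, b) to the norm in degree n with (a
    + 1, b + 1). The beta integral starts this induction. Identities between polynomials, such as
    the expansion of the parameter derivative and the reflection x -> - x, rest on a uniqueness
    principle: a polynomial of degree at most n that satisfies the n-th eigenvalue equation and has
    no term of degree n is zero. *)

Section derivation.
Variable R : realType.
Implicit Types (f g : R -> R) (x : R).

Lemma is_derive_mul f g x df dg : is_derive x 1 f df -> is_derive x 1 g dg ->
  is_derive x 1 (fun y => f y * g y) (df * g x + f x * dg).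
Proof.
move=> Hf Hg; apply: (@trigger_derive _ (f * g) x (f x *: dg + g x *: df)).
by rewrite /GRing.scale/= addrC mulrC.
Qed.

Lemma is_derive_add f g x df dg : is_derive x 1 f df -> is_derive x 1 g dg ->
  is_derive x 1 (fun y => f y + g y) (df + dg).
Proof. by move=> Hf Hg; exact: (is_deriveD Hf Hg). Qed.

Lemma is_derive_sub f g x df dg : is_derive x 1 f df -> is_derive x 1 g dg ->
  is_derive x 1 (fun y => f y - g y) (df - dg).
Proof. by move=> Hf Hg; exact: (is_deriveB Hf Hg). Qed.

Lemma is_derive_scale (k : R) f x df : is_derive x 1 f df ->
  is_derive x 1 (fun y => k * f y) (k * df).
Proof. by move=> Hf; exact: (is_deriveZ k Hf). Qed.

Lemma is_derive_inv f x df : f x != 0 -> is_derive x 1 f df ->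
  is_derive x 1 (fun y => (f y)^-1) (- df / f x ^+ 2).
Proof.
move=> fx0 Hf; apply: DeriveDef; first exact: derivableV.
by rewrite deriveV// derive_val /GRing.scale/= mulrC mulrN mulNr.
Qed.

Lemma is_derive_bigsum n (h : nat -> R -> R) x (dh : nat -> R) :
  (forall i, (i < n)%N -> is_derive x 1 (h i) (dh i)) ->
  is_derive x 1 (fun y => \sum_(i < n) h i y) (\sum_(i < n) dh i).
Proof.
move=> Hh; have := @is_derive_sum R R R n (fun i => h i) x 1 (fun i => dh i).
move=> /(_ (fun i => Hh i (ltn_ord i))).
by congr is_derive; apply/funext => y; rewrite fct_sumE.
Qed.

Lemma is_derive_chain f g x df dg : is_derive (f x) 1 g dg ->
  is_derive x 1 f df -> is_derive x 1 (fun y => g (f y)) (dg * df).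
Proof. by move=> Hg Hf; exact: is_derive1_comp. Qed.

Lemma is_derive_translate f (c x df : R) : is_derive (c + x) 1 f df ->
  is_derive x 1 (fun y => f (c + y)) df.
Proof.
move=> Hf; rewrite -[df]mulr1.
apply: (@is_derive_chain (fun y => c + y)) => //.
by have := is_derive_add (is_derive_cst c x 1) (is_derive_id x 1); rewrite add0r.
Qed.

Lemma is_derive_cont f x df : is_derive x 1 f df -> {for x, continuous f}.
Proof.
by move=> [+ _] => /derivable1_diffP/differentiable_continuous.
Qed.

Lemma is_derive_derive1 f x df : is_derive x 1 f df -> derive1 f x = df.
Proof. by move=> H; rewrite derive1E derive_val. Qed.

Lemma is_derive_unique f x df dg :
  is_derive x 1 f df -> is_derive x 1 f dg -> df = dg.
Proof. by move=> /is_derive_derive1 <- /is_derive_derive1. Qed.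

Lemma near_gt x (c : R) : c < x -> \forall y \near x, c < y.
Proof. by move=> cx; exact: lt_nbhsr. Qed.

(** Most closed forms below hold only on a half-line such as a > -1; as it is open, derivatives can
    be transferred between functions that agree there. *)
Lemma is_derive_near (c : R) f g x df : c < x -> (forall y, c < y -> f y = g y) ->
  is_derive x 1 f df -> is_derive x 1 g df.
Proof.
move=> cx fg; apply: near_eq_is_derive.
by near=> y; apply: fg; near: y; exact: near_gt.
Unshelve. all: by end_near. Qed.

End derivation.

Section exponential_family.
Context d (T : measurableType d) (R : realType).
Variables (mu : {measure set T -> \bar R}) (D : set T) (h phi : T -> R).
Hypotheses (mD : measurable D) (mh : measurable_fun D h)
  (mphi : measurable_fun D phi).
Hypothesis h_int : forall a : R, -1 < a ->
  mu.-integrable D (EFin \o (fun x => h x * expR (a * phi x))).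

(** The index j counts derivatives in a: each one brings down a factor [phi]. *)
Definition expfam (j : nat) (a : R) (x : T) : R :=
  phi x ^+ j * (h x * expR (a * phi x)).

Lemma expr_le_expR (x : R) j : 0 <= x -> x ^+ j <= j`!%:R * expR x.
Proof.
move=> x0; case: j => [|j].
  by rewrite expr0 mul1r -expR0 ler_expR.
have := expR_ge1Dxn j x0.
have f0 : 0 < (j.+1)`!%:R :> R by rewrite ltr0n fact_gt0.
move=> H; rewrite mulrC -ler_pdivrMr//; apply: le_trans H.
by rewrite lerDr.
Qed.

(** The power of |p| is paid for with a factor exp (e |p|), and moving from a to t costs another
    one, hence the margin 2 e. The sum of the two exponentials covers both signs of p. *)
Lemma expr_expR_bound (p a t e : R) j : 0 < e -> `|t - a| <= e ->
  `|p| ^+ j * expR (t * p) <=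
  j`!%:R / e ^+ j * (expR ((a - 2 * e) * p) + expR ((a + 2 * e) * p)).
Proof.
move=> e0 ta.
have H1 : `|p| ^+ j <= j`!%:R / e ^+ j * expR (e * `|p|).
  have := @expr_le_expR (e * `|p|) j (mulr_ge0 (ltW e0) (normr_ge0 _)).
  rewrite exprMn mulrAC ler_pdivlMr ?exprn_gt0//.
  by rewrite mulrC.
have H2 : expR (t * p) <= expR (a * p + e * `|p|).
  rewrite ler_expR -lerBlDl -mulrBl (le_trans (ler_norm _))// normrM.
  by rewrite ler_wpM2r.
have c0 : 0 <= j`!%:R / e ^+ j :> R by rewrite divr_ge0// exprn_ge0// ltW.
apply: (le_trans (ler_pM _ _ H1 H2)).
- by rewrite exprn_ge0.
- exact: expR_ge0.
rewrite -(mulrA (_ / _)) -expRD ler_wpM2l//.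
have [p0|p0] := leP 0 p.
  rewrite ger0_norm// -[leLHS]add0r lerD ?expR_ge0//.
  by rewrite ler_expR le_eqVlt; apply/orP; left; apply/eqP; ring.
rewrite ltr0_norm// -[leLHS]addr0 lerD ?expR_ge0//.
by rewrite ler_expR le_eqVlt; apply/orP; left; apply/eqP; ring.
Qed.

Lemma measurable_expfam j a : measurable_fun D (expfam j a).
Proof.
apply: measurable_funM; first exact: measurable_funX.
apply: measurable_funM => //; apply: measurableT_comp => //.
exact: measurable_funM.
Qed.

(** The bound depends on a and e but not on the parameter t near a, as differentiation under the
    integral sign requires. *)
Definition expfam_dom (j : nat) (a e : R) (x : T) : R :=
  j`!%:R / e ^+ j *
  (`|h x * expR ((a - 2 * e) * phi x)| + `|h x * expR ((a + 2 * e) * phi x)|).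

Lemma expfam_dom_ge0 j a e x : 0 < e -> 0 <= expfam_dom j a e x.
Proof.
by move=> e0; rewrite mulr_ge0 ?addr_ge0// divr_ge0// exprn_ge0// ltW.
Qed.

Lemma le_expfam_dom j a t e x : 0 < e -> `|t - a| <= e ->
  `|expfam j t x| <= expfam_dom j a e x.
Proof.
move=> e0 ta; rewrite /expfam /expfam_dom !normrM normrX.
rewrite !(ger0_norm (expR_ge0 _)) -mulrDr [leLHS]mulrCA [leRHS]mulrCA.
by rewrite ler_wpM2l// expr_expR_bound.
Qed.

Lemma integrable_expfam_dom j a e : 0 < e -> -1 < a - 2 * e ->
  mu.-integrable D (EFin \o expfam_dom j a e).
Proof.
move=> e0 ae; rewrite /expfam_dom.
rewrite (_ : _ \o _ = fun x => ((j`!%:R / e ^+ j)%:E *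
  ((`|h x * expR ((a - 2 * e) * phi x)|)%:E +
   (`|h x * expR ((a + 2 * e) * phi x)|)%:E))%E); last first.
  by apply/funext => x /=; rewrite EFinM EFinD.
apply: integrableZl => //; apply: integrableD => //.
  by apply: (@integrable_norm _ _ _ mu); exact: h_int.
apply: (@integrable_norm _ _ _ mu); apply: h_int.
by apply: (lt_trans ae); rewrite ltrD2l -subr_gt0 opprK; lra.
Qed.

Lemma integrable_expfam j a : -1 < a -> mu.-integrable D (EFin \o expfam j a).
Proof.
(* With this radius a - 2 e exceeds -1 by (a + 1) / 2, so both exponents of the dominating function
   stay in the range of [h_int]. *)
move=> a1; pose e := (a + 1) / 4.
have e0 : 0 < e by rewrite /e; lra.
apply: (@le_integrable _ _ _ mu D mD _ (EFin \o expfam_dom j a e)).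
- exact/measurable_EFinP/measurable_expfam.
- move=> x _ /=; rewrite lee_fin [leRHS]ger0_norm ?expfam_dom_ge0//.
  by rewrite le_expfam_dom// subrr normr0 ltW.
- by apply: integrable_expfam_dom => //; rewrite /e; lra.
Qed.

Lemma is_derive_expfam j (a : R) x :
  is_derive a 1 (fun a : R => expfam j a x) (expfam j.+1 a x).
Proof.
rewrite /expfam.
rewrite (_ : phi x ^+ j.+1 * _ =
  phi x ^+ j * (h x * (expR (a * phi x) * phi x))); last by rewrite exprS; ring.
apply: is_derive_scale; apply: is_derive_scale.
apply: (@is_derive_chain _ (fun a => a * phi x) expR).
have := is_derive_mul (is_derive_id a 1) (is_derive_cst (phi x) a 1).
by rewrite mul1r mulr0 addr0.
Qed.

Lemma is_derive_Rintegral_expfam j (a : R) : -1 < a ->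
  is_derive a 1 (fun a : R => \int[mu]_(x in D) expfam j a x)
                (\int[mu]_(x in D) expfam j.+1 a x).
Proof.
move=> a1; pose e := (a + 1) / 4.
have e0 : 0 < e by rewrite /e; lra.
have Ia : `]a - e, a + e[%classic a.
  by rewrite /= in_itv/=; apply/andP; split; lra.
have Igt t : `]a - e, a + e[%classic t -> -1 < t.
  by rewrite /= in_itv/= /e => /andP[]; lra.
have Id t y : `]a - e, a + e[%classic t -> D y ->
    derivable (fun t => expfam j t y) t 1.
  by move=> _ _; have [] := is_derive_expfam j t y.
have pE t y : partial1of2 (expfam j) t y = expfam j.+1 t y.
  by rewrite partial1of2E; have [_] := is_derive_expfam j t y.
have G_ub t y : `]a - e, a + e[%classic t -> D y ->
    `|partial1of2 (expfam j) t y| <= expfam_dom j.+1 a e y.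
  move=> It _; rewrite pE.
  apply: le_expfam_dom => //.
  by move: It; rewrite /= in_itv/= ler_distl => /andP[/ltW -> /ltW ->].
apply: DeriveDef.
  apply: (@derivable_under_integral _ _ _ mu _ _ mD _ _ _ Ia _ Id _ _ _ G_ub).
  - by move=> t /Igt; exact: integrable_expfam.
  - by move=> y; exact: expfam_dom_ge0.
  - by apply: integrable_expfam_dom => //; rewrite /e; lra.
rewrite -derive1E.
rewrite (@differentiation_under_integral _ _ _ mu _ _ mD _ _ _ Ia _ Id _ _ _ G_ub).
- by apply: eq_Rintegral => x _; rewrite pE.
- by move=> t /Igt; exact: integrable_expfam.
- by move=> y; exact: expfam_dom_ge0.
- by apply: integrable_expfam_dom => //; rewrite /e; lra.
Qed.

End exponential_family.

(** * The fundamental theorem of calculus on an open set exhausted by segments *)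

Section improper_integral.
Variables (R : realType) (D : set R) (a b : nat -> R) (f F : R -> R) (A B : R).
Let mu := @lebesgue_measure R.
Let I n : set R := `[a n, b n]%classic.
Hypotheses (oD : open D) (ab : forall n, a n < b n) (ndI : nondecreasing_seq I)
  (DI : D = \bigcup_n I n) (cf : forall x, D x -> {for x, continuous f})
  (dF : forall x, D x -> is_derive x 1 F (f x))
  (FA : F (a n) @[n --> \oo] --> A) (FB : F (b n) @[n --> \oo] --> B).

Let ID n x : I n x -> D x. Proof. by move=> Inx; rewrite DI; exists n. Qed.

Let mD : measurable D. Proof. exact: open_measurable. Qed.

Let mf : measurable_fun D f.
Proof.
by apply: open_continuous_measurable_fun => // x /set_mem; exact: cf.
Qed.

Lemma segment_FTC n : (\int[mu]_(x in I n) (f x)%:E = (F (b n) - F (a n))%:E)%E.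
Proof.
have Fc x : D x -> {for x, continuous F}.
  by move=> Dx; exact: is_derive_cont (dF Dx).
rewrite EFinB; apply: continuous_FTC2 => //.
- apply: continuous_in_subspaceT => x /set_mem /ID; exact: cf.
- split.
  + move=> x /subset_itv_oo_cc xI; have /dF[//] : D x by exact: (@ID n).
  + apply: cvg_at_right_filter; apply: Fc.
    by apply: (@ID n); rewrite /I/= in_itv/= lexx (ltW (ab n)).
  + apply: cvg_at_left_filter; apply: Fc.
    by apply: (@ID n); rewrite /I/= in_itv/= lexx (ltW (ab n)).
- move=> x /subset_itv_oo_cc xI.
  by rewrite (is_derive_derive1 (dF (@ID n x xI))).
Qed.

Lemma cvg_segment_FTC :
  (\int[mu]_(x in I n) (f x)%:E)%E @[n --> \oo] --> (B - A)%:E.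
Proof.
under eq_fun do rewrite segment_FTC.
by apply: cvg_EFin; [exact: nearW|exact: cvgB].
Qed.

Lemma ge0_integral_FTC : (forall x, D x -> 0 <= f x) ->
  (\int[mu]_(x in D) (f x)%:E = (B - A)%:E)%E.
Proof.
move=> f0; have mI n : measurable_fun (I n) (fun x => (f x)%:E).
  by apply/measurable_EFinP; apply: measurable_funS mf => // x; exact: ID.
apply: cvg_unique cvg_segment_FTC => //; rewrite DI.
apply: ge0_nondecreasing_set_cvg_integral => //.
  by move=> n; exact: measurable_itv.
by move=> n x /ID Dx; rewrite lee_fin f0.
Qed.

(** Finite limits of an antiderivative at both ends force integrability of a nonnegative function.
    The gamma and Jacobi integrands are then dominated by functions of this kind. *)
Lemma ge0_integrable_FTC : (forall x, D x -> 0 <= f x) ->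
  mu.-integrable D (EFin \o f).
Proof.
move=> f0; apply/integrableP; split; first exact/measurable_EFinP.
have -> : (\int[mu]_(x in D) `|(EFin \o f) x| = \int[mu]_(x in D) (f x)%:E)%E.
  by apply: eq_integral => x /set_mem Dx /=; rewrite ger0_norm// f0.
by rewrite ge0_integral_FTC// ltry.
Qed.

(** Here f may change sign, so monotone convergence is replaced by dominated convergence with |f| as
    the bound. *)
Lemma Rintegral_FTC : mu.-integrable D (EFin \o f) ->
  \int[mu]_(x in D) f x = B - A.
Proof.
move=> fint; rewrite /Rintegral.
suff -> : (\int[mu]_(x in D) (f x)%:E = (B - A)%:E)%E by [].
have IE n : (\int[mu]_(x in I n) (f x)%:E =
    \int[mu]_(x in D) (EFin \o f \_ (I n)) x)%E.
  have -> : (EFin \o f \_ (I n)) = ((EFin \o f) \_ (I n)).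
    by apply/funext => x; rewrite /= !patchE; case: ifP.
  by rewrite -integral_mkcondr setIidr// => x; exact: ID.
have mfI n : measurable_fun D (EFin \o f \_ (I n)).
  apply/measurable_EFinP.
  have -> : f \_ (I n) = (fun x => f x * \1_(I n) x).
    by apply/funext => x; rewrite patchE indicE; case: (x \in I n); rewrite ?mulr1 ?mulr0.
  by apply: measurable_funM => //; apply: measurable_indic; exact: measurable_itv.
have fI_f : {ae mu, forall x, D x ->
    (EFin \o f \_ (I n)) x @[n --> \oo] --> (EFin \o f) x}.
  apply: aeW => x Dx; apply: cvg_near_cst.
  have [m _ Imx] : (\bigcup_n I n) x by rewrite -DI.
  exists m => // k /= mk; rewrite patchE ifT// inE.
  by have /subsetPset := ndI mk; exact.
have fI_le : {ae mu, forall x n, D x ->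
    (`|(EFin \o f \_ (I n)) x| <= (EFin \o (Num.norm \o f)) x)%E}.
  apply: aeW => x n _ /=; rewrite lee_fin patchE; case: ifP => // _.
  by rewrite normr0.
have [_ _ H] := @dominated_convergence _ _ R mu D mD
  (fun n => EFin \o f \_ (I n)) (EFin \o f) (EFin \o (Num.norm \o f)) mfI
  (measurable_int _ fint) fI_f (integrable_norm fint) fI_le.
have := cvg_segment_FTC; rewrite (funext IE) => H'.
exact: cvg_unique H H'.
Qed.

End improper_integral.

Section exhaustions.
Variable R : realType.

Lemma natSS_gt1 n : 1 < n.+2%:R :> R. Proof. by rewrite ltr1n. Qed.

Lemma invSS_lt1 n : 0 < (n.+2%:R^-1 : R) < 1.
Proof. by rewrite invr_gt0 ltr0n/= invf_lt1 ?natSS_gt1 ?ltr0n. Qed.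

Lemma invSS_le m n : (m <= n)%N -> n.+2%:R^-1 <= m.+2%:R^-1 :> R.
Proof. by move=> mn; rewrite lef_pV2 ?posrE ?ltr0n// ler_nat. Qed.

Lemma cvg_invSS : (n.+2%:R^-1 : R) @[n --> \oo] --> (0 : R).
Proof.
by have := @cvg_harmonic R; rewrite -cvg_shiftS.
Qed.

Lemma invSS_lt (e : R) : 0 < e -> exists n, n.+2%:R^-1 < e.
Proof.
move=> e0; have /cvgrPdist_lt/(_ e e0)[n _ /(_ n (leqnn n))] := cvg_invSS.
by rewrite sub0r normrN ger0_norm ?invr_ge0// => H; exists n.
Qed.

Lemma itv11_exhaustion : `](-1), 1[%classic =
  \bigcup_n `[(-1 + n.+2%:R^-1 : R), 1 - n.+2%:R^-1]%classic.
Proof.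
apply/seteqP; split => x.
  rewrite /= in_itv/= => /andP[x1 x2].
  have [n Hn] : exists n, n.+2%:R^-1 < Num.min (x + 1) (1 - x).
    by apply: invSS_lt; rewrite lt_min; apply/andP; split; lra.
  exists n => //=; rewrite in_itv/=; move: Hn; rewrite lt_min => /andP[].
  move: (n.+2%:R^-1) => e.
  by move=> *; apply/andP; split; lra.
move=> [n _] /=; rewrite !in_itv/= => /andP[]; have /andP[] := invSS_lt1 n.
move: (n.+2%:R^-1) => e.
by move=> *; apply/andP; split; lra.
Qed.

Lemma itv11_exhaustion_nd : nondecreasing_seq
  (fun n => `[(-1 + n.+2%:R^-1 : R), 1 - n.+2%:R^-1]%classic).
Proof.
move=> m n mn; apply/subsetPset => x; rewrite /= !in_itv/= => /andP[].
have := invSS_le mn; move: (n.+2%:R^-1) (m.+2%:R^-1) => e e'.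
by move=> *; apply/andP; split; lra.
Qed.

Lemma itv0y_exhaustion : `]0, +oo[%classic =
  \bigcup_n `[(n.+2%:R^-1 : R), n.+2%:R]%classic.
Proof.
apply/seteqP; split => x.
  rewrite /= in_itv/= andbT => x0.
  have [n Hn] := invSS_lt x0.
  have [m Hm] : exists m : nat, x < m%:R.
    by exists (Num.truncn x).+1; rewrite truncnS_gt.
  exists (n + m)%N => //=; rewrite in_itv/=; apply/andP; split.
    by apply: le_trans (ltW Hn); apply: invSS_le; rewrite leq_addr.
  by apply: (le_trans (ltW Hm)); rewrite ler_nat
    (leq_trans (leq_addl n m))// -addn2 leq_addr.
move=> [n _] /=; rewrite !in_itv/= andbT => /andP[H _]; apply: lt_le_trans H.
by rewrite invr_gt0 ltr0n.
Qed.

Lemma itv0y_exhaustion_nd : nondecreasing_seq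
  (fun n => `[(n.+2%:R^-1 : R), n.+2%:R]%classic).
Proof.
move=> m n mn; apply/subsetPset => x; rewrite /= !in_itv/= => /andP[H1 H2].
by rewrite (le_trans (invSS_le mn) H1) (le_trans H2)// ler_nat.
Qed.

End exhaustions.

(** Differentiability on an open half-line supplies the continuity at both endpoints of the segment
    as well. *)
Lemma MVT_right (R : realType) (c : R) (f df : R -> R) (a b : R) :
  (forall x, c < x -> is_derive x 1 f (df x)) -> c < a -> a < b ->
  exists2 x, a < x < b & f b - f a = df x * (b - a).
Proof.
move=> Hf ca ab.
have [||x] := @MVT R f df a b ab.
- by move=> x; rewrite in_itv/= => /andP[ax _]; apply: Hf; exact: lt_trans ax.
- apply: continuous_in_subspaceT => x /set_mem /=; rewrite in_itv/= => /andP[ax _].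
  by apply: is_derive_cont (Hf x _); exact: lt_le_trans ax.
- by rewrite in_itv/= => xab H; exists x.
Qed.

Lemma nondecreasing_right (R : realType) (c : R) (f df : R -> R) (a b : R) :
  (forall x, c < x -> is_derive x 1 f (df x)) ->
  (forall x, c < x -> 0 <= df x) -> c < a -> a <= b -> f a <= f b.
Proof.
move=> Hf df0 ca; rewrite le_eqVlt => /predU1P[->//|ab].
have [x /andP[ax _] H] := MVT_right Hf ca ab.
rewrite -subr_ge0 H mulr_ge0// ?subr_ge0 ?(ltW ab)//.
by apply: df0; exact: lt_trans ax.
Qed.

Lemma constant_right (R : realType) (c : R) (f : R -> R) (a b : R) :
  (forall x, c < x -> is_derive x 1 f 0) -> c < a -> c < b -> f a = f b.
Proof.
move=> Hf ca cb; wlog ab : a b ca cb / a <= b => [H|].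
  by have [ab|/ltW ba] := leP a b; [exact: H|apply/esym; exact: H].
move: ab; rewrite le_eqVlt => /predU1P[->//|ab].
have [x _] := MVT_right Hf ca ab.
by rewrite mul0r => /eqP; rewrite subr_eq0 => /eqP.
Qed.

(** A zero integral would make f vanish almost everywhere on D; as f has no zero there, D would lie
    in a null set. *)
Lemma Rintegral_gt0 d (T : measurableType d) (R : realType)
    (mu : {measure set T -> \bar R}) (D : set T) (f : T -> R) :
  measurable D -> (0 < mu D)%E -> mu.-integrable D (EFin \o f) ->
  (forall x, D x -> 0 < f x) -> 0 < \int[mu]_(x in D) f x.
Proof.
move=> mD muD fint f0.
rewrite lt_neqAle Rintegral_ge0 ?andbT; last by move=> x /f0/ltW.
apply/eqP => I0; have mf : measurable_fun D (EFin \o f) by exact: measurable_int fint.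
have /(ae_eq_integral_abs mu mD mf) : (\int[mu]_(x in D) `|(EFin \o f) x| = 0)%E.
  have -> : (\int[mu]_(x in D) `|(EFin \o f) x| = \int[mu]_(x in D) (EFin \o f) x)%E.
    by apply: eq_integral => x /set_mem /f0/ltW fx /=; rewrite ger0_norm.
  by rewrite -[LHS]fineK ?integrable_fin_num//; congr EFin.
move=> [N [mN N0 HN]].
have : (mu D <= mu N)%E.
  apply: le_measure; rewrite ?inE// => x Dx; apply: HN => /= /(_ Dx) [fx0].
  by have := f0 x Dx; rewrite fx0 ltxx.
by rewrite leNgt N0 muD.
Qed.

(** * Log-convexity of exponential integrals in their parameter *)

Section log_convexity.
Context d (T : measurableType d) (R : realType).
Variables (mu : {measure set T -> \bar R}) (D : set T) (h phi : T -> R).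
Hypotheses (mD : measurable D) (muD : (0 < mu D)%E)
  (mh : measurable_fun D h) (mphi : measurable_fun D phi)
  (h_gt0 : forall x, D x -> 0 < h x).
Hypothesis h_int : forall a : R, -1 < a ->
  mu.-integrable D (EFin \o (fun x => h x * expR (a * phi x))).

Let F j (a : R) := \int[mu]_(x in D) expfam h phi j a x.

Let dF j (a : R) : -1 < a -> is_derive a 1 (F j) (F j.+1 a).
Proof. exact: is_derive_Rintegral_expfam. Qed.

Lemma Rintegral_expfam_gt0 (a : R) : -1 < a -> 0 < F 0 a.
Proof.
move=> a1; apply: Rintegral_gt0 => //; first exact: integrable_expfam.
by move=> x Dx; rewrite /expfam expr0 mul1r mulr_gt0 ?expR_gt0 ?h_gt0.
Qed.

Lemma Rintegral_expfam_cauchy_schwarz (a : R) : -1 < a ->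
  F 1 a ^+ 2 <= F 0 a * F 2 a.
Proof.
move=> a1; have F0 := Rintegral_expfam_gt0 a1.
have int j : mu.-integrable D (EFin \o expfam h phi j a) by exact: integrable_expfam.
have intZ k j : mu.-integrable D (EFin \o (fun x => k * expfam h phi j a x)).
  rewrite (_ : _ \o _ = fun x => (k%:E * (expfam h phi j a x)%:E)%E)//.
  exact: (integrableZl mD k (int j)).
(* This quadratic in c is the integral of (phi - c)^2 against the positive weight. Its minimiser c =
   F 1 a / F 0 a, inserted below, gives the inequality. *)
have key (c : R) : 0 <= F 2 a + (- 2 * c * F 1 a + c ^+ 2 * F 0 a).
  have : 0 <= \int[mu]_(x in D) (expfam h phi 2 a x +
      ((- 2 * c) * expfam h phi 1 a x + c ^+ 2 * expfam h phi 0 a x)).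
    apply: Rintegral_ge0 => x Dx; rewrite /expfam expr0 expr1 mul1r.
    have : 0 <= h x * expR (a * phi x) by rewrite mulr_ge0 ?expR_ge0 ?ltW ?h_gt0.
    move: (h x * _) => w w0.
    rewrite [leRHS](_ : _ = (phi x - c) ^+ 2 * w); last by ring.
    exact: mulr_ge0 (sqr_ge0 _) w0.
  have int01 := integrableD mD (intZ (- 2 * c) 1%N) (intZ (c ^+ 2) 0%N).
  rewrite (RintegralD mD (int 2%N) int01) (RintegralD mD (intZ _ _) (intZ _ _)).
  by rewrite (RintegralZl _ mD (int 1%N)) (RintegralZl _ mD (int 0%N)).
have := mulr_ge0 (ltW F0) (key (F 1 a / F 0 a)).
rewrite -[in X in _ -> X]subr_ge0 => /le_trans; apply.
rewrite le_eqVlt; apply/orP; left; apply/eqP.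
by field; rewrite gt_eqF.
Qed.

Lemma is_derive_ln_expfam (a : R) : -1 < a ->
  is_derive a 1 (fun a => ln (F 0 a)) (F 1 a / F 0 a).
Proof.
move=> a1; rewrite mulrC.
exact: is_derive_chain (is_derive1_ln (Rintegral_expfam_gt0 a1)) (dF 0 a1).
Qed.

Lemma expfam_logder_nondecreasing (a b : R) : -1 < a -> a <= b ->
  F 1 a / F 0 a <= F 1 b / F 0 b.
Proof.
pose G x := F 1 x / F 0 x.
pose dG x := F 2 x * (F 0 x)^-1 + F 1 x * (- F 1 x / F 0 x ^+ 2).
have H (x : R) : -1 < x -> is_derive x 1 G (dG x).
  move=> x1; apply: is_derive_mul; first exact: dF.
  by apply: is_derive_inv; [rewrite gt_eqF ?Rintegral_expfam_gt0|exact: dF].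
apply: (nondecreasing_right H) => x x1; rewrite /dG.
have F0 := Rintegral_expfam_gt0 x1.
rewrite [leRHS](_ : _ = (F 0 x * F 2 x - F 1 x ^+ 2) / F 0 x ^+ 2); last first.
  by field; rewrite gt_eqF.
by rewrite divr_ge0 ?sqr_ge0// subr_ge0 Rintegral_expfam_cauchy_schwarz.
Qed.

(** The mean value theorem gives the increment as a value of the nondecreasing logarithmic
    derivative. The step has length 1 because the functional equations of the gamma and beta
    integrals evaluate exactly such increments. *)
Lemma expfam_logder_bounds (a : R) : -1 < a ->
  F 1 a / F 0 a <= ln (F 0 (a + 1)) - ln (F 0 a) <= F 1 (a + 1) / F 0 (a + 1).
Proof.
move=> a1; have aa : a < a + 1 by rewrite ltrDl.
have [x /andP[ax xa] ->] := MVT_right is_derive_ln_expfam a1 aa.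
rewrite addrAC subrr add0r mulr1.
by rewrite !expfam_logder_nondecreasing ?(ltW ax) ?(ltW xa)// (lt_trans a1).
Qed.

End log_convexity.

(** * The gamma function *)

Section gamma.
Variable R : realType.
Implicit Types (x y t a : R).

Lemma powR_expR t a : 0 < t -> t `^ a = expR (a * ln t).
Proof. by move=> t0; rewrite /powR gt_eqF. Qed.

Lemma cvg_powR_to0 (u : nat -> R) a : 0 < a -> (forall n, 0 < u n) ->
  u n @[n --> \oo] --> (0 : R) -> u n `^ a @[n --> \oo] --> (0 : R).
Proof.
move=> a0 u0 ucvg; have /cvg_at_rightP := powR_cvg0 a0; apply.
by split.
Qed.

Lemma cvg_powR_to1 (u : nat -> R) a :
  u n @[n --> \oo] --> (1 : R) -> u n `^ a @[n --> \oo] --> (1 : R).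
Proof.
move=> ucvg; have c1 : {for (1 : R), continuous (fun y : R => y `^ a)}.
  exact: is_derive_cont (is_derive1_powR a (@ltr01 R)).
have := continuous_cvg _ c1 ucvg; rewrite powR1; exact.
Qed.

(** The logarithm is concave and lies below its tangent at 1 / e; the slope e is left free for the
    estimates below. *)
Lemma ln_le_tangent e t : 0 < e -> 0 < t -> ln t <= e * t - 1 - ln e.
Proof.
move=> e0 t0; rewrite lerBrDr -lnM ?posrE// [t * e]mulrC.
have et0 : 0 < e * t by exact: mulr_gt0.
have := @le_ln1Dx R (e * t - 1).
by rewrite addrCA subrr addr0 => -> //; rewrite ltrBrDl subrr.
Qed.

Lemma is_derive_expR_comp (f : R -> R) x df : is_derive x 1 f df ->
  is_derive x 1 (fun y => expR (f y)) (expR (f x) * df).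
Proof. by move=> Hf; apply: is_derive_chain. Qed.

Lemma cvg_invSS_powR (p : R) : 0 < p ->
  (n.+2%:R^-1 : R) `^ p @[n --> \oo] --> 0.
Proof.
by move=> p0; apply: cvg_powR_to0 => //; exact: cvg_invSS.
Qed.

Lemma gamma_integrable a : -1 < a ->
  (@lebesgue_measure R).-integrable `]0, +oo[%classic
    (EFin \o (fun t => expR (- t) * expR (a * ln t))).
Proof.
move=> a1.
(* [F t = (t / (1 + t)) ^ (a + 1)] is bounded and its derivative is comparable
   to [t ^ a] near [0]. *)
pose F t := expR ((a + 1) * (ln t - ln (1 + t))).
pose f t := expR ((a + 1) * (ln t - ln (1 + t))) *
  ((a + 1) * (t^-1 - (1 + t)^-1)).
have dF t : 0 < t -> is_derive t 1 F (f t).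
  move=> t0; apply: is_derive_expR_comp; apply: is_derive_scale.
  apply: is_derive_sub; first exact: is_derive1_ln.
  by apply: is_derive_translate; apply: is_derive1_ln; rewrite addr_gt0.
have tP t : `]0, +oo[%classic t <-> 0 < t by rewrite /= in_itv/= andbT.
have df t : 0 < t -> {for t, continuous f}.
  move=> t0; have t1 : 0 < 1 + t by rewrite addr_gt0.
  have H1 := is_derive_cont (dF t t0).
  apply: continuousM; first exact: H1.
  apply: continuousM; first exact: cst_continuous.
  apply: continuousB; first by apply: inv_continuous; rewrite gt_eqF.
  apply: (@continuous_comp _ _ _ (fun y => 1 + y) (fun y => y^-1)).
    by apply: continuousD; [exact: cst_continuous|exact: cvg_id].
  by apply: inv_continuous; rewrite gt_eqF.
have f0 t : 0 < t -> 0 <= f t.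
  move=> t0; rewrite mulr_ge0 ?expR_ge0// mulr_ge0 ?subr_ge0//; first by lra.
  by rewrite lef_pV2 ?posrE ?addr_gt0// lerDr.
have FE t : 0 < t -> F t = (1 + t^-1)^-1 `^ (a + 1).
  move=> t0; have t1 : 0 < 1 + t by rewrite addr_gt0.
  rewrite powR_expR ?invr_gt0 ?addr_gt0 ?invr_gt0// /F -ln_div ?posrE//.
  congr (expR (_ * ln _)); field.
  by rewrite !gt_eqF//; lra.
have fint : (@lebesgue_measure R).-integrable `]0, +oo[%classic (EFin \o f).
  apply: (@ge0_integrable_FTC R _ (fun n => n.+2%:R^-1) (fun n => n.+2%:R) f F 0 1).
  - exact: interval_open.
  - move=> n; have /andP[_ H] := invSS_lt1 R n.
    by apply: (lt_trans H); exact: natSS_gt1.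
  - exact: itv0y_exhaustion_nd.
  - exact: itv0y_exhaustion.
  - by move=> t /tP; exact: df.
  - by move=> t /tP; exact: dF.
  - apply: (@cvg_trans _ ((n.+3%:R^-1 : R) `^ (a + 1) @[n --> \oo])).
      apply: near_eq_cvg; near=> n; rewrite FE ?invr_gt0 ?ltr0n// invrK.
      by rewrite -[n.+3]add1n natrD.
    have a10 : 0 < a + 1 by lra.
    by have := cvg_invSS_powR a10; rewrite -cvg_shiftS.
  - apply: (@cvg_trans _ ((1 + n.+2%:R^-1 : R)^-1 `^ (a + 1) @[n --> \oo])).
      by apply: near_eq_cvg; near=> n; rewrite FE ?ltr0n.
    apply: cvg_powR_to1; rewrite -[X in _ --> X]invr1; apply: cvgV.
      by rewrite oner_eq0.
    rewrite -[X in _ --> X]addr0; apply: cvgD; first exact: cvg_cst.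
    exact: cvg_invSS.
  - by move=> t /tP; exact: f0.
(* As f t = (a + 1) t^a (1 + t)^(- a - 2), the comparison amounts to (a + 2) ln (1 + t) <= t + K.
   The tangent of the logarithm at a + 2 yields exactly this K. *)
pose K := 1 - (a + 2) * (1 + ln (a + 2)^-1).
have mle t : 0 < t -> expR (- t) * expR (a * ln t) <= expR K / (a + 1) * f t.
  move=> t0; have t1 : 0 < 1 + t by rewrite addr_gt0.
  have a2 : 0 < a + 2 by lra.
  have -> : f t = (a + 1) * expR (a * ln t - (a + 2) * ln (1 + t)).
    rewrite /f (_ : t^-1 - _ = expR (- ln t - ln (1 + t))); last first.
      by rewrite expRB expRN !lnK ?posrE//; field; rewrite !gt_eqF.
    by rewrite mulrCA -expRD; congr (_ * expR _); ring.
  rewrite mulrA divfK; last by rewrite gt_eqF//; lra.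
  rewrite -!expRD ler_expR.
  have a2' : 0 < (a + 2)^-1 by rewrite invr_gt0.
  have := ln_le_tangent a2' t1.
  rewrite -(ler_pM2l a2) /K.
  rewrite (_ : (a + 2) * ((a + 2)^-1 * (1 + t) - 1 - ln (a + 2)^-1) =
    (1 + t) - (a + 2) - (a + 2) * ln (a + 2)^-1); last by field; rewrite gt_eqF.
  move: (ln (a + 2)^-1) (ln (1 + t)) (ln t) => u v w.
  by lra.
apply: (@le_integrable _ _ R (@lebesgue_measure R) _ (measurable_itv _) _
  (fun t => ((expR K / (a + 1))%:E * (f t)%:E)%E)) => //.
- apply/measurable_EFinP; apply: measurable_funM.
    by apply: measurableT_comp => //; exact: measurable_funN.
  apply: measurableT_comp => //; apply: measurable_funM => //.
  by apply: measurable_funTS; exact: measurable_ln.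
- move=> t /tP t0 /=; rewrite lee_fin ger0_norm ?mulr_ge0 ?expR_ge0//.
  by apply: (le_trans (mle t t0)); exact: ler_norm.
- exact: integrableZl.
Unshelve. all: by end_near. Qed.

End gamma.

Section gamma_function.
Variable R : realType.
Implicit Types (x y t a : R).

(** The j-th derivative of Γ on the positive half-line. The shift x - 1 turns the range a > -1 of
    the exponential family into x > 0. *)
Definition log_gamma_integral (j : nat) x : R :=
  \int[@lebesgue_measure R]_(t in `]0, +oo[)
    expfam (fun t => expR (- t)) (@ln R) j (x - 1) t.

Local Notation G := log_gamma_integral.

Let measurable_expN D : measurable_fun D (fun t : R => expR (- t)).
Proof.
by apply: measurableT_comp => //; exact: measurable_funN.
Qed.

Let measurable_ln' D : measurable_fun D (@ln R).
Proof. by apply: measurable_funTS; exact: measurable_ln. Qed.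

Let itv0y_gt0 : (0 < @lebesgue_measure R `]0%R, +oo[%classic)%E.
Proof. by rewrite lebesgue_measure_itv/= ltry ltry. Qed.

Lemma euler_integralE x : euler_integral x = G 0 x.
Proof.
apply: eq_Rintegral => t; rewrite inE/= in_itv/= andbT => t0.
by rewrite /expfam expr0 mul1r mulrC powR_expR.
Qed.

Lemma Gamma_pos x : 0 < x -> Gamma x = G 0 x.
Proof. by move=> x0; rewrite /Gamma x0 euler_integralE. Qed.

Let sub1_gt x : 0 < x -> -1 < x - 1. Proof. by move=> x0; lra. Qed.

Lemma is_derive_log_gamma_integral j x : 0 < x -> is_derive x 1 (G j) (G j.+1 x).
Proof.
move=> /sub1_gt x0; rewrite -[G j.+1 x]mulr1.
have dx : is_derive x 1 (fun y : R => y - 1) (1 : R).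
  by have := is_derive_sub (is_derive_id x 1) (is_derive_cst (1 : R) x 1); rewrite subr0.
have H := @is_derive_Rintegral_expfam _ _ R (@lebesgue_measure R) _ _ _
  (measurable_itv _) (@measurable_expN _) (@measurable_ln' _)
  (@gamma_integrable R) j _ x0.
exact: (@is_derive_chain _ (fun y => y - 1) _ x _ _ H dx).
Qed.

Lemma Gamma_gt0 x : 0 < x -> 0 < Gamma x.
Proof.
move=> x0; rewrite Gamma_pos//.
exact: (@Rintegral_expfam_gt0 _ _ R (@lebesgue_measure R) _ _ _
  (measurable_itv _) itv0y_gt0 (@measurable_expN _) (@measurable_ln' _)
  (fun t _ => expR_gt0 _) (@gamma_integrable R) _ (sub1_gt x0)).
Qed.

Lemma GammaS x : 0 < x -> Gamma (x + 1) = x * Gamma x.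
Proof.
move=> x0; have x10 : 0 < x + 1 by rewrite addr_gt0.
rewrite !Gamma_pos// /G addrK.
pose g a t := expR (- t) * expR (a * ln t).
have gE a : \int[@lebesgue_measure R]_(t in `]0, +oo[)
    expfam (fun t => expR (- t)) (@ln R) 0 a t =
    \int[@lebesgue_measure R]_(t in `]0, +oo[) g a t.
  by apply: eq_Rintegral => t _; rewrite /expfam expr0 mul1r.
rewrite !{}gE.
have gint a : -1 < a ->
  (@lebesgue_measure R).-integrable `]0, +oo[%classic (EFin \o g a).
  exact: gamma_integrable.
have int1 := gint _ (sub1_gt x0).
have int2 : (@lebesgue_measure R).-integrable `]0, +oo[%classic (EFin \o g x).
  by apply: gint; lra.
have int1' : (@lebesgue_measure R).-integrable `]0, +oo[%classic
    (EFin \o (fun t => x * g (x - 1) t)).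
  rewrite (_ : EFin \o _ = fun t => (x%:E * (EFin \o g (x - 1)%R) t)%E)//.
  exact: integrableZl.
have tP t : `]0, +oo[%classic t <-> 0 < t by rewrite /= in_itv/= andbT.
have dg a t : 0 < t -> is_derive t 1 (g a) (a * g (a - 1) t - g a t).
  move=> t0.
  have dN : is_derive t 1 (fun t : R => - t) (-1) by exact: is_deriveNid.
  have H := is_derive_mul (is_derive_expR_comp dN)
    (is_derive_expR_comp (is_derive_scale a (is_derive1_ln t0))).
  apply: is_derive_eq H _; rewrite /g mulrBl mul1r expRB lnK ?posrE//.
  by field; rewrite gt_eqF.
have cg a t : 0 < t -> {for t, continuous (g a)}.
  by move=> t0; exact: is_derive_cont (dg a t t0).
(* Integration by parts: the integrand is the derivative of t^x exp (- t), which vanishes at 0 and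
   at infinity. *)
have : \int[@lebesgue_measure R]_(t in `]0, +oo[) (x * g (x - 1) t - g x t) = 0 - 0.
  apply: (@Rintegral_FTC R _ (fun n => n.+2%:R^-1) (fun n => n.+2%:R) _ (g x) 0 0).
  - exact: interval_open.
  - move=> n; have /andP[_ H] := invSS_lt1 R n.
    by apply: (lt_trans H); exact: natSS_gt1.
  - exact: itv0y_exhaustion_nd.
  - exact: itv0y_exhaustion.
  - move=> t /tP t0; apply: continuousB; last exact: cg.
    by apply: continuousM; [exact: cst_continuous|exact: cg].
  - by move=> t /tP; exact: dg.
  - apply: (@squeeze_cvgr _ _ _ _ (fun=> 0) (fun n => (n.+2%:R^-1 : R) `^ x)).
    + near=> n; rewrite /g mulr_ge0 ?expR_ge0//=.
      by rewrite powR_expR ?invr_gt0 ?ltr0n// -[leRHS]mul1r ler_wpM2r ?expR_ge0.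
    + exact: cvg_cst.
    + exact: cvg_invSS_powR.
  (* The tangent of slope 1 / (2 x) gives x ln t <= t / 2 + c, so the boundary term is at most exp c
     exp (- t / 2); then exp (- t / 2) <= 2 / t makes it O(1 / n). *)
  - pose c := x * (- 1 - ln (2 * x)^-1).
    apply: (@squeeze_cvgr _ _ _ _ (fun=> 0) (fun n => (expR c * 2) * (n.+2%:R^-1 : R))).
    + near=> n; set t : R := n.+2%:R; have t0 : 0 < t by rewrite ltr0n.
      rewrite /g mulr_ge0 ?expR_ge0//= -expRD.
      apply: (@le_trans _ _ (expR c * expR (- (t / 2)))).
        rewrite -expRD ler_expR.
        have x2 : 0 < (2 * x)^-1 by rewrite invr_gt0 mulr_gt0.
        have := ln_le_tangent x2 t0; rewrite -(ler_pM2l x0) /c.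
        rewrite (_ : x * ((2 * x)^-1 * t - 1 - ln (2 * x)^-1) =
          t / 2 + x * (- 1 - ln (2 * x)^-1)); last by field; rewrite gt_eqF.
        by move: (x * ln t) (x * _) => u v; lra.
      rewrite -mulrA ler_wpM2l ?expR_ge0// expRN.
      rewrite -[2 / t]invf_div lef_pV2 ?posrE ?expR_gt0 ?divr_gt0//.
      by apply: le_trans (expR_ge1Dx _); rewrite lerDr.
    + exact: cvg_cst.
    + rewrite -[X in _ --> X](mulr0 (expR c * 2)).
      by apply: cvgM; [exact: cvg_cst|exact: cvg_invSS].
  - rewrite (_ : EFin \o _ = (EFin \o (fun t => (x * g (x - 1) t)%R)) \-
      (EFin \o g x))%E//.
    exact: integrableB.
rewrite RintegralB// RintegralZl// subr0.
by move=> /eqP; rewrite subr_eq0 => /eqP.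
Unshelve. all: by end_near. Qed.

Definition digam x : R := G 1 x / G 0 x.

(** The quotient rule applied to Γ' / Γ. This explicit form makes continuity visible and agrees with
    [trigamma] for x > 0. *)
Definition trigam x : R := (G 0 x * G 2 x - G 1 x ^+ 2) / G 0 x ^+ 2.

Lemma is_derive_lnGamma x : 0 < x -> is_derive x 1 (fun y => ln (Gamma y)) (digam x).
Proof.
move=> x0; have G0 : 0 < G 0 x by rewrite -Gamma_pos// Gamma_gt0.
apply: (@is_derive_near _ 0 (fun y => ln (G 0 y))) => //.
  by move=> y y0; rewrite Gamma_pos.
rewrite /digam mulrC.
exact: is_derive_chain (is_derive1_ln G0) (is_derive_log_gamma_integral 0 x0).
Qed.

Lemma is_derive_digam x : 0 < x -> is_derive x 1 digam (trigam x).
Proof.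
move=> x0; have G0 : 0 < G 0 x by rewrite -Gamma_pos// Gamma_gt0.
have G00 : G 0 x != 0 by rewrite gt_eqF.
have H := is_derive_mul (is_derive_log_gamma_integral 1 x0)
  (is_derive_inv G00 (is_derive_log_gamma_integral 0 x0)).
by apply: is_derive_eq H _; rewrite /trigam; field.
Qed.

Lemma continuous_trigam x : 0 < x -> {for x, continuous trigam}.
Proof.
move=> x0; have G0 : 0 < G 0 x by rewrite -Gamma_pos// Gamma_gt0.
have G00 : G 0 x * G 0 x != 0 by rewrite mulf_neq0 ?gt_eqF.
have dG j := is_derive_log_gamma_integral j x0.
have H0 := is_derive_mul (dG 0) (dG 0).
have -> : trigam = fun y => (G 0 y * G 2 y - G 1 y * G 1 y) / (G 0 y * G 0 y).
  by [].
exact: (is_derive_cont (is_derive_mul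
  (is_derive_sub (is_derive_mul (dG 0) (dG 2)) (is_derive_mul (dG 1) (dG 1)))
  (@is_derive_inv _ (fun y => G 0 y * G 0 y) _ _ G00 H0))).
Qed.

Lemma lnGammaS x : 0 < x -> ln (Gamma (x + 1)) = ln x + ln (Gamma x).
Proof. by move=> x0; rewrite GammaS// lnM ?posrE ?Gamma_gt0. Qed.

Lemma digamS x : 0 < x -> digam (x + 1) = digam x + x^-1.
Proof.
move=> x0; have x10 : 0 < 1 + x by rewrite addr_gt0.
have H1 : is_derive x 1 (fun y => ln (Gamma (1 + y))) (digam (1 + x)).
  exact: is_derive_translate (is_derive_lnGamma x10).
have H2 := is_derive_add (is_derive1_ln x0) (is_derive_lnGamma x0).
have H3 : is_derive x 1 (fun y => ln (Gamma (1 + y))) (x^-1 + digam x).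
  by apply: is_derive_near x0 _ H2 => y y0; rewrite [1 + y]addrC lnGammaS.
by rewrite [x + 1]addrC [RHS]addrC; exact: is_derive_unique H1 H3.
Qed.

Lemma trigamS x : 0 < x -> trigam (x + 1) = trigam x - x ^- 2.
Proof.
move=> x0; have x10 : 0 < 1 + x by rewrite addr_gt0.
have H1 := is_derive_translate (is_derive_digam x10).
have x00 : x != 0 by rewrite gt_eqF.
have H2 := is_derive_add (is_derive_digam x0) (is_derive_inv x00 (is_derive_id x 1)).
have H3 : is_derive x 1 (fun y => digam (1 + y)) (trigam x + -1 / x ^+ 2).
  by apply: is_derive_near x0 _ H2 => y y0; rewrite [1 + y]addrC digamS.
by rewrite [x + 1]addrC (is_derive_unique H1 H3) mulN1r.
Qed.

(** By the functional equation ln Γ increases by exactly ln x from x to x + 1, so log-convexity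
    brackets ln x. *)
Lemma digam_bounds x : 0 < x -> digam x <= ln x <= digam (x + 1).
Proof.
move=> x0; have H : -1 < x - 1 by exact: sub1_gt.
have := @expfam_logder_bounds _ _ R (@lebesgue_measure R) `]0, +oo[%classic
  (fun t => expR (- t)) (@ln R) (measurable_itv _) itv0y_gt0
  (@measurable_expN _) (@measurable_ln' _) (fun t _ => expR_gt0 _)
  (@gamma_integrable R) _ H.
have x1E : x - 1 + 1 = x + 1 - 1 by ring.
rewrite x1E -!/(G _ _) -/(digam _) -/(digam _).
rewrite -!Gamma_pos ?addr_gt0// lnGammaS//.
by rewrite addrK.
Qed.

End gamma_function.

(** * Gamma and trigamma on (-1, 0), and the removable singularities at s = 0 *)

Section trigamma_values.
Variable R : realType.
Implicit Types (x y t s : R).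

(** Since s > -1, a nonpositive argument n + s occurs only for n = 0 and lies in (-1, 0]. Off the
    pole one step of the functional equation reaches the Euler integral. *)
Lemma Gamma_itvN10 x : -1 < x < 0 -> Gamma x = Gamma (1 + x) / x.
Proof.
move=> /andP[x1 x0]; rewrite /Gamma ltNge (ltW x0)/=.
have x10 : 0 < 1 + x by lra.
have -> : Num.truncn (- x) = 0%N.
  by apply/truncn0Pn; rewrite -ltNge; lra.
by rewrite x10 addrC /pochhammer big_ord_recl big_ord0 mulr1 addr0.
Qed.

Lemma trigamma_pos x : 0 < x -> trigamma x = trigam x.
Proof.
move=> x0; rewrite /trigamma /=; apply: is_derive_derive1.
apply: is_derive_near x0 _ (is_derive_digam x0) => y y0; apply/esym.
apply: is_derive_derive1; apply: is_derive_near y0 _ (is_derive_lnGamma y0) => z z0.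
by rewrite gtr0_norm ?Gamma_gt0.
Qed.

Lemma near_itvN10 x : -1 < x < 0 -> \forall y \near x, -1 < y < 0.
Proof.
move=> /andP[x1 x0]; near=> y; apply/andP; split; near: y.
  exact: lt_nbhsr.
exact: lt_nbhsl.
Unshelve. all: by end_near. Qed.

(** On this interval ln |Γ(x)| = ln Γ(1 + x) - ln (- x), and the second derivative of - ln (- x) is
    1 / x^2. *)
Lemma trigamma_itvN10 x : -1 < x < 0 -> trigamma x = trigam (1 + x) + x ^- 2.
Proof.
move=> xI; rewrite /trigamma /=; apply: is_derive_derive1.
pose f y := digam (1 + y) - y^-1.
have xN0 : x != 0 by case/andP: xI => _ /lt_eqF ->.
have df : is_derive x 1 f (trigam (1 + x) + x ^- 2).
  have x10 : 0 < 1 + x by case/andP: xI; lra.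
  have := is_derive_sub (is_derive_translate (is_derive_digam x10))
    (is_derive_inv xN0 (is_derive_id x 1)).
  by rewrite mulN1r opprK.
apply: near_eq_is_derive df; near=> y.
have yI : -1 < y < 0 by near: y; exact: near_itvN10.
apply/esym/is_derive_derive1.
have y10 : 0 < 1 + y by case/andP: yI; lra.
have dN : is_derive y 1 (fun z : R => - z) (-1) by exact: is_deriveNid.
have yN : 0 < - y by case/andP: yI; lra.
have := is_derive_sub (is_derive_translate (is_derive_lnGamma y10))
  (is_derive_chain (is_derive1_ln yN) dN).
rewrite invrN mulrN1 opprK; apply: near_eq_is_derive; near=> z.
have zI : -1 < z < 0 by near: z; exact: near_itvN10.
have z10 : 0 < 1 + z by case/andP: zI; lra.
have z0 : z < 0 by case/andP: zI.
rewrite (Gamma_itvN10 zI) normrM normfV (ltr0_norm z0) gtr0_norm ?Gamma_gt0//.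
by rewrite ln_div ?posrE ?Gamma_gt0 ?oppr_gt0.
Unshelve. all: by end_near. Qed.

(** For n = 0 the three singular terms sit at the same point, and their double poles cancel by the
    recurrence of the trigamma function. The right-hand side is regular at x = 0. *)
Lemma neg_trigamma_add_inv x : -1 < x -> x != 0 ->
  - 2 * trigamma x + trigamma x + 1 / x ^+ 2 = - trigam (1 + x).
Proof.
move=> x1 x0; suff -> : trigamma x = trigam (1 + x) + x ^- 2 by field.
have [xlt0|xgt0|xE] := ltgtP x 0; last by rewrite xE eqxx in x0.
  by rewrite trigamma_itvN10// x1.
by rewrite trigamma_pos// [1 + x]addrC trigamS// subrK.
Qed.

Lemma trigamma_partE n s : -1 < s -> trigamma_part n s =
  if n is 0 then - trigam (1 + s)
  else - 2 * trigam (2 * n%:R + s) + trigam (n%:R + s) + 1 / (2 * n%:R + s) ^+ 2.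
Proof.
move=> s1; rewrite /trigamma_part /by_continuity; case: n => [|n]; last first.
  have n1 : 1 <= n.+1%:R :> R by rewrite ler1n.
  by rewrite gt_eqF ?trigamma_pos//; lra.
rewrite add0r; case: eqVneq => [->|s0].
  apply/cvg_lim => //.
  apply: (@cvg_trans _ (- trigam (1 + t) @[t --> (0 : R)^'])).
    apply: near_eq_cvg; near=> t.
    rewrite mulr0 !add0r neg_trigamma_add_inv//.
      by near: t; apply: nbhs_dnbhs; apply: lt_nbhsr; rewrite ltrN10.
    by near: t; exact: nbhs_dnbhs_neq.
  apply: cvgN; apply: continuous_cvg.
    by apply: continuous_trigam; rewrite addr0.
  by apply: cvgD; [exact: cvg_cst|exact: nbhs_dnbhs].
by rewrite mulr0 !add0r neg_trigamma_add_inv.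
Unshelve. all: by end_near. Qed.

Lemma mul_Gamma x : -1 < x -> x != 0 -> Gamma x * x = Gamma (1 + x).
Proof.
move=> x1 x0; have [xlt0|xgt0|xE] := ltgtP x 0; last by rewrite xE eqxx in x0.
  by rewrite Gamma_itvN10 ?x1// divfK.
by rewrite addrC GammaS// mulrC.
Qed.

(** For n = 0 the product is s Γ(s) = Γ(1 + s), whose continuity at s = 0 gives the limit in the
    definition. *)
Lemma Gamma_mulE n s : -1 < s -> Gamma_mul n s =
  if n is 0 then Gamma (1 + s) else Gamma (n%:R + s) * (2 * n%:R + s).
Proof.
move=> s1; rewrite /Gamma_mul /by_continuity; case: n => [|n]; last first.
  have n1 : 1 <= n.+1%:R :> R by rewrite ler1n.
  by rewrite gt_eqF//; lra.
rewrite add0r; case: eqVneq => [->|s0]; last by rewrite mulr0 !add0r mul_Gamma.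
apply/cvg_lim => //.
apply: (@cvg_trans _ (Gamma (1 + t) @[t --> (0 : R)^'])).
  apply: near_eq_cvg; near=> t; rewrite mulr0 !add0r mul_Gamma//.
    by near: t; apply: nbhs_dnbhs; apply: lt_nbhsr; rewrite ltrN10.
  by near: t; exact: nbhs_dnbhs_neq.
apply: continuous_cvg.
  rewrite addr0; apply: (@is_derive_cont _ _ _ (log_gamma_integral 1 1)).
  apply: is_derive_near ltr01 _ (is_derive_log_gamma_integral 0 ltr01) => y y0.
  by rewrite Gamma_pos.
by apply: cvgD; [exact: cvg_cst|exact: nbhs_dnbhs].
Unshelve. all: by end_near. Qed.

Lemma Gamma_mul_gt0 n s : -1 < s -> 0 < Gamma_mul n s.
Proof.
move=> s1; rewrite Gamma_mulE//; case: n => [|n]; first by rewrite Gamma_gt0//; lra.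
have n1 : 1 <= n.+1%:R :> R by rewrite ler1n.
by rewrite mulr_gt0 ?Gamma_gt0//; lra.
Qed.

(* Both sides are [Gamma (n + s + 2) (2 n + s + 2)]. *)
Lemma Gamma_mulS n s : -1 < s ->
  Gamma_mul n (s + 2) = (n.+1%:R + s) * Gamma_mul n.+1 s.
Proof.
move=> s1; rewrite !Gamma_mulE//; last by lra.
have n1 : 0 < n.+1%:R + s by have : 1 <= n.+1%:R :> R; [rewrite ler1n|lra].
case: n n1 => [|n] n1.
  have -> : 1 + (s + 2) = 1%:R + s + 1 + 1 by ring.
  by rewrite GammaS ?GammaS//; [ring|lra].
have -> : n.+1%:R + (s + 2) = n.+2%:R + s + 1 by rewrite -[n.+2]addn1 natrD; ring.
by rewrite GammaS// -[n.+2]addn1 natrD; ring.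
Qed.

End trigamma_values.

(** * Integration against the Jacobi weight *)

Section jacobi_integral.
Variable R : realType.
Implicit Types (x y t a b : R) (p q : {poly R}).

Local Notation mu := (@lebesgue_measure R).

(* Polynomials are taken in the variable [y = (x - 1) / 2] in which [jacobi] is
   expanded; [1 - x = - 2 y] and [1 + x = 2 (1 + y)]. *)
Definition jacobi_integral (j : nat) a b q : R :=
  \int[mu]_(x in `](-1), 1[)
    expfam (fun x => (1 + x) `^ b * q.[(x - 1) / 2]) (fun x => ln (1 - x)) j a x.

Local Notation J := jacobi_integral.

Lemma itv11P x : `](-1), 1[%classic x <-> 0 < 1 + x /\ 0 < 1 - x.
Proof.
rewrite /= in_itv/=; split => [/andP[]|[]]; first by split; lra.
by move=> *; apply/andP; split; lra.
Qed.

Lemma expfam_jacobi j a b q x : `](-1), 1[%classic x ->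
  expfam (fun x => (1 + x) `^ b * q.[(x - 1) / 2]) (fun x => ln (1 - x)) j a x =
  ln (1 - x) ^+ j * (jacobi_weight a b x * q.[(x - 1) / 2]).
Proof.
move=> /itv11P[x1 x2].
by rewrite /expfam /jacobi_weight (powR_expR a x2); congr (_ * _); ring.
Qed.

Lemma is_derive_powR_1x b x : 0 < 1 + x ->
  is_derive x 1 (fun x => (1 + x) `^ b) (b * (1 + x) `^ (b - 1)).
Proof.
by move=> x1; apply: (@is_derive_translate _ (fun y => y `^ b)); exact: is_derive1_powR.
Qed.

Lemma is_derive_powR_1Nx a x : 0 < 1 - x ->
  is_derive x 1 (fun x => (1 - x) `^ a) (- (a * (1 - x) `^ (a - 1))).
Proof.
move=> x1; have dN := is_derive_sub (is_derive_cst (1 : R) x 1) (is_derive_id x 1).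
have := @is_derive_chain _ (fun y => 1 - y) (fun y => y `^ a) x _ _
  (is_derive1_powR a x1) dN.
by rewrite sub0r mulrN1.
Qed.

Lemma powR_le_on12 b t : 1 <= t <= 2 -> t `^ b <= 1 + 2 `^ b.
Proof.
move=> /andP[t1 t2]; have [b0|b0] := leP 0 b.
  apply: (@le_trans _ _ (2 `^ b)); last by rewrite lerDr.
  by apply: ge0_ler_powR => //; rewrite nnegrE//; lra.
apply: (@le_trans _ _ 1); last by rewrite lerDl powR_ge0.
by rewrite -(powRr0 t) ler_powR// ltW.
Qed.

Lemma cvg_powR_2 (u : nat -> R) a :
  u n @[n --> \oo] --> (2 : R) -> u n `^ a @[n --> \oo] --> (2 `^ a : R).
Proof.
move=> ucvg; have c2 : {for (2 : R), continuous (fun y : R => y `^ a)}.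
  exact: is_derive_cont (is_derive1_powR a (@ltr0Sn R 1)).
exact: continuous_cvg _ c2 ucvg.
Qed.

Let lft n : R := -1 + n.+2%:R^-1.
Let rgt n : R := 1 - n.+2%:R^-1.

Let cvg_lft1 : 1 + lft n @[n --> \oo] --> (0 : R).
Proof.
have -> : (fun n => 1 + lft n) = (fun n => n.+2%:R^-1).
  by apply/funext => n; rewrite /lft addrA subrr add0r.
exact: cvg_invSS.
Qed.

Let cvg_rgt1 : 1 - rgt n @[n --> \oo] --> (0 : R).
Proof.
have -> : (fun n => 1 - rgt n) = (fun n => n.+2%:R^-1).
  by apply/funext => n; rewrite /rgt opprB addrC subrK.
exact: cvg_invSS.
Qed.

Let cvg_lft2 : 1 - lft n @[n --> \oo] --> (2 : R).
Proof.
have -> : (fun n => 1 - lft n) = (fun n => 2 - n.+2%:R^-1).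
  by apply/funext => n; rewrite /lft; ring.
rewrite -[X in _ --> X]subr0; apply: cvgB; first exact: cvg_cst.
exact: cvg_invSS.
Qed.

Let cvg_rgt2 : 1 + rgt n @[n --> \oo] --> (2 : R).
Proof.
have -> : (fun n => 1 + rgt n) = (fun n => 2 - n.+2%:R^-1).
  by apply/funext => n; rewrite /rgt; ring.
rewrite -[X in _ --> X]subr0; apply: cvgB; first exact: cvg_cst.
exact: cvg_invSS.
Qed.

Let lft1_gt0 n : 0 < 1 + lft n.
Proof. by rewrite /lft addrA subrr add0r invr_gt0 ltr0n. Qed.

Let rgt1_gt0 n : 0 < 1 - rgt n.
Proof. by rewrite /rgt opprB addrC subrK invr_gt0 ltr0n. Qed.

Let lft_rgt n : lft n < rgt n.
Proof.
have /andP[_] := invSS_lt1 R n.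
by rewrite /lft /rgt; move: (n.+2%:R^-1) => e e1; lra.
Qed.

Let integrable11_FTC (f F : R -> R) (A B : R) :
  (forall x, 0 < 1 + x -> 0 < 1 - x -> 0 <= f x) ->
  (forall x, 0 < 1 + x -> 0 < 1 - x -> {for x, continuous f}) ->
  (forall x, 0 < 1 + x -> 0 < 1 - x -> is_derive x 1 F (f x)) ->
  F (lft n) @[n --> \oo] --> A -> F (rgt n) @[n --> \oo] --> B ->
  mu.-integrable `](-1), 1[%classic (EFin \o f).
Proof.
move=> f0 cf dF FA FB.
apply: (@ge0_integrable_FTC R _ lft rgt f F A B) => //.
- exact: itv11_exhaustion_nd.
- exact: itv11_exhaustion.
- by move=> x /itv11P[]; exact: cf.
- by move=> x /itv11P[]; exact: dF.
- by move=> x /itv11P[]; exact: f0.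
Qed.

Let Rintegral11_FTC (f F : R -> R) (A B : R) :
  mu.-integrable `](-1), 1[%classic (EFin \o f) ->
  (forall x, 0 < 1 + x -> 0 < 1 - x -> {for x, continuous f}) ->
  (forall x, 0 < 1 + x -> 0 < 1 - x -> is_derive x 1 F (f x)) ->
  F (lft n) @[n --> \oo] --> A -> F (rgt n) @[n --> \oo] --> B ->
  \int[mu]_(x in `](-1), 1[) f x = B - A.
Proof.
move=> fint cf dF FA FB.
apply: (@Rintegral_FTC R _ lft rgt f F A B) => //.
- exact: itv11_exhaustion_nd.
- exact: itv11_exhaustion.
- by move=> x /itv11P[]; exact: cf.
- by move=> x /itv11P[]; exact: dF.
Qed.

Let measurable_1x D : measurable_fun D (fun x : R => 1 + x).
Proof. exact: measurable_funD. Qed.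

Let measurable_1Nx D : measurable_fun D (fun x : R => 1 - x).
Proof. exact: measurable_funB. Qed.

Lemma measurable_ln_1Nx D : measurable_fun D (fun x : R => ln (1 - x)).
Proof. by apply: measurableT_comp => //; exact: measurable_ln. Qed.

Lemma measurable_powR_1x b D : measurable_fun D (fun x : R => (1 + x) `^ b).
Proof. exact: (@measurableT_comp _ _ _ _ _ _ (fun y : R => y `^ b)). Qed.

Lemma horner_continuous q : continuous (fun x : R => q.[(x - 1) / 2]).
Proof.
move=> x; apply: (@continuous_comp _ _ _ (fun x => (x - 1) / 2) (horner q)).
  apply: continuousM; last exact: cst_continuous.
  by apply: continuousB; [exact: cvg_id|exact: cst_continuous].
exact: continuous_horner.
Qed.

Lemma measurable_horner q D : measurable_fun D (fun x : R => q.[(x - 1) / 2]).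
Proof.
by apply: measurable_funTS; apply: continuous_measurable_fun; exact: horner_continuous.
Qed.

(** The sum (1 - x)^a + (1 + x)^b has an explicit antiderivative with finite limits and dominates
    the weight: on each half of the interval one of the two bases lies in [1, 2], so that its power
    is bounded. *)
Lemma jacobi_weight_integrable a b : -1 < a -> -1 < b ->
  mu.-integrable `](-1), 1[%classic (EFin \o
    (fun x : R => (1 + x) `^ b * expR (a * ln (1 - x)))).
Proof.
move=> a1 b1.
have a10 : 0 < a + 1 by lra.
have b10 : 0 < b + 1 by lra.
pose f x := (1 - x) `^ a + (1 + x) `^ b.
pose F x := (b + 1)^-1 * (1 + x) `^ (b + 1) - (a + 1)^-1 * (1 - x) `^ (a + 1).
have dF x : 0 < 1 + x -> 0 < 1 - x -> is_derive x 1 F (f x).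
  move=> x1 x2.
  have := is_derive_sub (is_derive_scale (b + 1)^-1 (is_derive_powR_1x (b + 1) x1))
    (is_derive_scale (a + 1)^-1 (is_derive_powR_1Nx (a + 1) x2)).
  rewrite !addrK mulrN opprK !mulKf ?gt_eqF//.
  by rewrite [X in is_derive _ _ _ X -> _]addrC.
have cf x : 0 < 1 + x -> 0 < 1 - x -> {for x, continuous f}.
  move=> x1 x2; apply: continuousD.
    exact: is_derive_cont (is_derive_powR_1Nx a x2).
  exact: is_derive_cont (is_derive_powR_1x b x1).
have fint : mu.-integrable `](-1), 1[%classic (EFin \o f).
  apply: (@integrable11_FTC f F (0 - (a + 1)^-1 * 2 `^ (a + 1))
     ((b + 1)^-1 * 2 `^ (b + 1) - 0)) => //.
  - by move=> x _ _; rewrite addr_ge0 ?powR_ge0.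
  - apply: cvgB.
      rewrite -[X in _ --> X](mulr0 (b + 1)^-1).
      by apply: cvgM; [exact: cvg_cst|exact: cvg_powR_to0].
    by apply: cvgM; [exact: cvg_cst|exact: cvg_powR_2].
  - apply: cvgB.
      by apply: cvgM; [exact: cvg_cst|exact: cvg_powR_2].
    rewrite -[X in _ --> X](mulr0 (a + 1)^-1).
    by apply: cvgM; [exact: cvg_cst|exact: cvg_powR_to0].
pose C := (1 + 2 `^ a) + (1 + 2 `^ b) : R.
have wf x : 0 < 1 + x -> 0 < 1 - x ->
    (1 + x) `^ b * expR (a * ln (1 - x)) <= C * f x.
  move=> x1 x2; rewrite -powR_expR// /C /f.
  have pa t : 0 <= (t `^ a : R) := powR_ge0 t a.
  have pb t : 0 <= (t `^ b : R) := powR_ge0 t b.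
  have [x0|x0] := leP 0 x.
    have H : (1 + x) `^ b <= 1 + 2 `^ b by apply: powR_le_on12; lra.
    apply: (le_trans (ler_wpM2r (pa _) H)).
    by rewrite ler_pM ?addr_ge0 ?lerDr ?lerDl ?addr_ge0.
  have H : (1 - x) `^ a <= 1 + 2 `^ a by apply: powR_le_on12; lra.
  rewrite mulrC; apply: (le_trans (ler_wpM2r (pb _) H)).
  by rewrite ler_pM ?addr_ge0 ?lerDr ?lerDl ?addr_ge0.
apply: (@le_integrable _ _ R mu _ (measurable_itv _) _
  (fun t => (C%:E * (f t)%:E)%E)) => //.
- apply/measurable_EFinP; apply: measurable_funM; first exact: measurable_powR_1x.
  apply: measurableT_comp => //; apply: measurable_funM => //.
  exact: measurable_ln_1Nx.
- move=> t /itv11P[t1 t2] /=.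
  rewrite lee_fin ger0_norm ?mulr_ge0 ?expR_ge0 ?powR_ge0//.
  by apply: (le_trans (wf t t1 t2)); exact: ler_norm.
- exact: integrableZl.
Qed.

Lemma jacobi_integrable a b q : -1 < a -> -1 < b ->
  mu.-integrable `](-1), 1[%classic (EFin \o
    (fun x : R => ((1 + x) `^ b * q.[(x - 1) / 2]) * expR (a * ln (1 - x)))).
Proof.
move=> a1 b1.
pose C := \sum_(i < size q) `|q`_i|.
have qC x : 0 < 1 + x -> 0 < 1 - x -> `|q.[(x - 1) / 2]| <= C.
  move=> x1 x2; rewrite horner_coef; apply: le_trans (ler_norm_sum _ _ _) _.
  apply: ler_sum => i _; rewrite normrM normrX ler_piMr// exprn_ile1//.
  by rewrite ler_norml; lra.
apply: (@le_integrable _ _ R mu _ (measurable_itv _) _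
  (fun x => (C%:E * ((1 + x) `^ b * expR (a * ln (1 - x)))%:E)%E)).
- apply/measurable_EFinP; apply: measurable_funM.
    by apply: measurable_funM; [exact: measurable_powR_1x|exact: measurable_horner].
  apply: measurableT_comp => //; apply: measurable_funM => //.
  exact: measurable_ln_1Nx.
- move=> x /itv11P[x1 x2] /=; rewrite lee_fin mulrAC mulrC !normrM.
  rewrite ler_wpM2r ?mulr_ge0// (ger0_norm (_ : 0 <= C)) ?qC//.
  exact: le_trans (qC x x1 x2).
- apply: integrableZl => //; exact: jacobi_weight_integrable.
Qed.

Lemma integrable_expfam_jacobi j a b q : -1 < a -> -1 < b ->
  mu.-integrable `](-1), 1[%classic (EFin \o
    expfam (fun x => (1 + x) `^ b * q.[(x - 1) / 2]) (fun x => ln (1 - x)) j a).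
Proof.
move=> a1 b1; apply: integrable_expfam => //.
- by apply: measurable_funM; [exact: measurable_powR_1x|exact: measurable_horner].
- exact: measurable_ln_1Nx.
- by move=> c c1; exact: jacobi_integrable.
Qed.

Lemma is_derive_jacobi_integral j a b q : -1 < a -> -1 < b ->
  is_derive a 1 (fun a => J j a b q) (J j.+1 a b q).
Proof.
move=> a1 b1; apply: is_derive_Rintegral_expfam => //.
- by apply: measurable_funM; [exact: measurable_powR_1x|exact: measurable_horner].
- exact: measurable_ln_1Nx.
- by move=> c c1; exact: jacobi_integrable.
Qed.

Lemma jacobi_integralE j a b q : J j a b q =
  \int[mu]_(x in `](-1), 1[)
    (ln (1 - x) ^+ j * (jacobi_weight a b x * q.[(x - 1) / 2])).
Proof. by apply: eq_Rintegral => x /set_mem xI; rewrite expfam_jacobi. Qed.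

Lemma jacobi_integralD j a b p q : -1 < a -> -1 < b ->
  J j a b (p + q) = J j a b p + J j a b q.
Proof.
move=> a1 b1; rewrite /J -RintegralD//; try exact: integrable_expfam_jacobi.
by apply: eq_Rintegral => x _; rewrite /expfam hornerD; ring.
Qed.

Lemma jacobi_integralZ j a b c p : -1 < a -> -1 < b ->
  J j a b (c *: p) = c * J j a b p.
Proof.
move=> a1 b1; rewrite /J -RintegralZl//; try exact: integrable_expfam_jacobi.
by apply: eq_Rintegral => x _; rewrite /expfam hornerZ; ring.
Qed.

Lemma jacobi_integralSl j a b q : J j (a + 1) b q = J j a b (- 2 *: 'X * q).
Proof.
rewrite !jacobi_integralE; apply: eq_Rintegral => x /set_mem /itv11P[x1 x2].
rewrite /jacobi_weight powRD; last by rewrite (gt_eqF x2) implybT.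
rewrite powRr1 ?(ltW x2)//.
by rewrite hornerM hornerZ hornerX; field.
Qed.

Lemma jacobi_integralSr j a b q : J j a (b + 1) q = J j a b (2 *: ('X + 1) * q).
Proof.
rewrite !jacobi_integralE; apply: eq_Rintegral => x /set_mem /itv11P[x1 x2].
rewrite /jacobi_weight powRD; last by rewrite (gt_eqF x1) implybT.
rewrite powRr1 ?(ltW x1)//.
by rewrite hornerM hornerZ hornerD hornerX hornerC; field.
Qed.

(* The integrand is, up to a constant factor, the derivative of
   [(1 - x) ^ (a + 1) (1 + x) ^ (b + 1) q], which vanishes at both ends. *)
Lemma jacobi_integral_pearson a b q : -1 < a -> -1 < b ->
  J 0 a b (((a + 1)%:P + (a + b + 2) *: 'X) * q + 'X * ('X + 1) * q^`()) = 0.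
Proof.
move=> a1 b1; have a10 : 0 < a + 1 by lra.
have b10 : 0 < b + 1 by lra.
set r := (X in J 0 a b X).
pose F x := (- 2)^-1 * ((1 - x) `^ (a + 1) * ((1 + x) `^ (b + 1) * q.[(x - 1) / 2])).
pose f x := expfam (fun x => (1 + x) `^ b * r.[(x - 1) / 2]) (fun x => ln (1 - x)) 0 a x.
have dF x : 0 < 1 + x -> 0 < 1 - x -> is_derive x 1 F (f x).
  move=> x1 x2.
  have dy : is_derive x 1 (fun x : R => (x - 1) / 2) (2^-1 : R).
    have := is_derive_mul (is_derive_sub (is_derive_id x 1) (is_derive_cst (1 : R) x 1))
      (is_derive_cst (2^-1 : R) x 1).
    by rewrite subr0 mul1r mulr0 addr0.
  have dq := @is_derive_chain _ (fun x => (x - 1) / 2) (horner q) x _ _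
    (is_derive_poly q _) dy.
  have := is_derive_scale (- 2)^-1 (is_derive_mul (is_derive_powR_1Nx (a + 1) x2)
    (is_derive_mul (is_derive_powR_1x (b + 1) x1) dq)).
  move=> H; apply: is_derive_eq H _; rewrite /f /expfam expr0 mul1r -powR_expR//.
  have pa : (1 - x) `^ (a + 1) = (1 - x) `^ a * (1 - x).
    by rewrite powRD ?powRr1 ?(ltW x2)// (gt_eqF x2) implybT.
  have pb : (1 + x) `^ (b + 1) = (1 + x) `^ b * (1 + x).
    by rewrite powRD ?powRr1 ?(ltW x1)// (gt_eqF x1) implybT.
  rewrite !addrK pa pb /r !(hornerD, hornerM, hornerC, hornerX, hornerZ).
  by field.
have cf x : 0 < 1 + x -> 0 < 1 - x -> {for x, continuous f}.
  move=> x1 x2; apply: continuousM; first exact: cst_continuous.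
  apply: continuousM.
    apply: continuousM; first exact: is_derive_cont (is_derive_powR_1x b x1).
    exact: horner_continuous.
  have dN := is_derive_sub (is_derive_cst (1 : R) x 1) (is_derive_id x 1).
  have dln := @is_derive_chain _ (fun y => 1 - y) _ x _ _ (is_derive1_ln x2) dN.
  exact: is_derive_cont (is_derive_expR_comp (is_derive_scale a dln)).
rewrite -[RHS](subr0 0); apply: (@Rintegral11_FTC _ F) => //.
- exact: integrable_expfam_jacobi.
- rewrite -[X in _ --> X](mulr0 (- 2)^-1); apply: cvgM; first exact: cvg_cst.
  rewrite -[X in _ --> X](mulr0 (2 `^ (a + 1))); apply: cvgM.
    exact: cvg_powR_2.
  rewrite -[X in _ --> X](mul0r (q.[(-1 - 1) / 2])); apply: cvgM.
    exact: cvg_powR_to0.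
  apply: (continuous_cvg _ (@horner_continuous q (-1))).
  rewrite -[X in _ --> X]addr0; apply: cvgD; first exact: cvg_cst.
  exact: cvg_invSS.
- rewrite -[X in _ --> X](mulr0 (- 2)^-1); apply: cvgM; first exact: cvg_cst.
  rewrite -[X in _ --> X](mul0r (2 `^ (b + 1) * q.[(1 - 1) / 2])); apply: cvgM.
    exact: cvg_powR_to0.
  apply: cvgM; first exact: cvg_powR_2.
  apply: (continuous_cvg _ (@horner_continuous q 1)).
  rewrite -[X in _ --> X]subr0; apply: cvgB; first exact: cvg_cst.
  exact: cvg_invSS.
Qed.

Lemma jacobi_integral_base b : -1 < b -> J 0 0 b 1 = 2 `^ (b + 1) / (b + 1).
Proof.
move=> b1; have b10 : 0 < b + 1 by lra.
have N10 : -1 < 0 :> R by rewrite ltrN10.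
have JE : J 0 0 b 1 = \int[mu]_(x in `](-1), 1[) (1 + x) `^ b.
  by apply: eq_Rintegral => x _; rewrite /expfam expr0 mul0r expR0 hornerC !mulr1 mul1r.
rewrite JE -[RHS]subr0.
apply: (@Rintegral11_FTC _ (fun x => (1 + x) `^ (b + 1) / (b + 1))).
- have := jacobi_weight_integrable N10 b1; congr (_.-integrable _ _).
  by apply/funext => x /=; rewrite mul0r expR0 mulr1.
- by move=> x x1 x2; exact: is_derive_cont (is_derive_powR_1x b x1).
- move=> x x1 x2.
  have := is_derive_scale (b + 1)^-1 (is_derive_powR_1x (b + 1) x1).
  rewrite addrK mulKf ?gt_eqF// => H.
  by apply: is_derive_near (_ : -1 < x) _ H => [|y _]; [lra|rewrite mulrC].
- rewrite -[X in _ --> X](mul0r (b + 1)^-1).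
  by apply: cvgM; [exact: cvg_powR_to0|exact: cvg_cst].
- by apply: cvgM; [exact: cvg_powR_2|exact: cvg_cst].
Qed.

End jacobi_integral.

(** * The beta integral in terms of the gamma function *)

Section beta_gamma.
Variable R : realType.
Implicit Types (x y a b : R).

Local Notation mu := (@lebesgue_measure R).
Local Notation J := (@jacobi_integral R).

Lemma Gamma1 : Gamma (1 : R) = 1.
Proof.
rewrite Gamma_pos// /log_gamma_integral subrr.
have N10 : -1 < 0 :> R by rewrite ltrN10.
have := gamma_integrable N10; set f := (fun t : R => _) => fint.
have fE t : f t = expR (- t) by rewrite /f mul0r expR0 mulr1.
have tP (t : R) : `]0, +oo[%classic t <-> 0 < t by rewrite /= in_itv/= andbT.
have dF (t : R) : is_derive t 1 (fun t => - expR (- t)) (f t).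
  have dN : is_derive t 1 (fun t : R => - t) (-1) by exact: is_deriveNid.
  have := is_derive_scale (-1) (is_derive_expR_comp dN).
  rewrite mulrN1 mulN1r opprK -fE => H.
  by apply: is_derive_near (_ : t - 1 < t) _ H => [|y _]; [lra|rewrite mulN1r].
transitivity (0 - (-1) : R); last by rewrite sub0r opprK.
transitivity (\int[mu]_(t in `]0, +oo[) f t).
  by apply: eq_Rintegral => t _; rewrite /expfam expr0 mul1r.
apply: (@Rintegral_FTC R _ (fun n => n.+2%:R^-1) (fun n => n.+2%:R) _
  (fun t => - expR (- t)) (-1) 0) => //.
- move=> n; have /andP[_ H] := invSS_lt1 R n.
  by apply: (lt_trans H); exact: natSS_gt1.
- exact: itv0y_exhaustion_nd.
- exact: itv0y_exhaustion.
- move=> t _; have -> : f = (fun t => expR (- t)) by apply/funext.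
  apply: continuous_comp; first exact: opp_continuous.
  exact: continuous_expR.
- apply: cvgN; rewrite -[X in _ --> X](@expR0 R).
  apply: continuous_cvg; first exact: continuous_expR.
  by rewrite -[X in _ --> X]oppr0; apply: cvgN; exact: cvg_invSS.
- rewrite -[X in _ --> X]oppr0; apply: cvgN.
  by have := @cvgn_expR R; rewrite -cvg_shiftS -cvg_shiftS.
Qed.

Lemma lebesgue_measure_itv11_gt0 : (0 < mu `](-1)%R, 1%R[%classic)%E.
Proof. by rewrite lebesgue_measure_itv/= lte_fin ifT; [rewrite -EFinB lte_fin; lra|lra]. Qed.

Lemma jacobi_integral1_gt0 a b : -1 < a -> -1 < b -> 0 < J 0 a b 1.
Proof.
move=> a1 b1; apply: Rintegral_gt0.
- exact: measurable_itv.
- exact: lebesgue_measure_itv11_gt0.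
- exact: integrable_expfam_jacobi.
- move=> x /itv11P[x1 x2]; rewrite expfam_jacobi; last by apply/itv11P.
  by rewrite expr0 mul1r hornerC mulr1 mulr_gt0// powR_gt0.
Qed.

(** The integration by parts with q = 1 gives the first moment of y in terms of the total mass, and
    raising a inserts the factor 1 - x = - 2 y. *)
Lemma jacobi_integral1_Sl a b : -1 < a -> -1 < b ->
  J 0 (a + 1) b 1 = 2 * (a + 1) / (a + b + 2) * J 0 a b 1.
Proof.
move=> a1 b1; have := jacobi_integral_pearson 1 a1 b1.
rewrite derivC !mulr0 addr0 mulr1 jacobi_integralD// -[(a + 1)%:P]mulr1 mul_polyC.
rewrite !jacobi_integralZ// => H.
rewrite jacobi_integralSl mulr1 jacobi_integralZ//.
have ab0 : a + b + 2 != 0 by rewrite gt_eqF//; lra.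
have -> : J 0 a b 'X = - ((a + 1) * J 0 a b 1) / (a + b + 2).
  by apply: (canRL (mulfK ab0)); apply/eqP; rewrite -addr_eq0 mulrC addrC H.
by field.
Qed.

Section fixed_b.
Variable b : R.
Hypothesis b1 : -1 < b.

Let psiW a := J 1 a b 1 / J 0 a b 1.

Let psiW_bounds a : -1 < a ->
  psiW a <= ln (J 0 (a + 1) b 1) - ln (J 0 a b 1) <= psiW (a + 1).
Proof.
apply: expfam_logder_bounds.
- exact: measurable_itv.
- exact: lebesgue_measure_itv11_gt0.
- by apply: measurable_funM; [exact: measurable_powR_1x|exact: measurable_horner].
- exact: measurable_ln_1Nx.
- by move=> x /itv11P[x1 _]; rewrite hornerC mulr1 powR_gt0.
- by move=> c c1; exact: jacobi_integrable.
Qed.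

Let ln_WS a : -1 < a -> ln (J 0 (a + 1) b 1) =
  ln 2 + ln (a + 1) - ln (a + b + 2) + ln (J 0 a b 1).
Proof.
move=> a1; have ab0 : 0 < a + b + 2 by move: b1; lra.
have a10 : 0 < a + 1 by lra.
rewrite jacobi_integral1_Sl// lnM ?posrE ?jacobi_integral1_gt0// ?divr_gt0 ?mulr_gt0//.
by rewrite ln_div ?posrE ?mulr_gt0// lnM ?posrE.
Qed.

(** The logarithm of the quotient of the two sides of the beta-gamma relation, up to a constant
    depending on b. The term a ln 2 accounts for the power of 2. *)
Let rho a := ln (J 0 a b 1) + ln (Gamma (b + 2 + a)) - ln (Gamma (1 + a)) - a * ln 2.

Let drho a := psiW a + digam (b + 2 + a) - digam (1 + a) - ln 2.

Let rho_derive a : -1 < a -> is_derive a 1 rho (drho a).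
Proof.
move=> a1; have W0 := jacobi_integral1_gt0 a1 b1.
have H1 : is_derive a 1 (fun a => ln (J 0 a b 1)) (psiW a).
  rewrite /psiW mulrC.
  exact: is_derive_chain (is_derive1_ln W0) (is_derive_jacobi_integral 0 1 a1 b1).
have b2a : 0 < b + 2 + a by move: b1; lra.
have a10 : 0 < 1 + a by lra.
have H2 := is_derive_translate (is_derive_lnGamma b2a).
have H3 := is_derive_translate (is_derive_lnGamma a10).
have H4 := is_derive_mul (is_derive_id a 1) (is_derive_cst (ln 2 : R) a 1).
rewrite mul1r mulr0 addr0 in H4.
exact: is_derive_sub (is_derive_sub (is_derive_add H1 H2) H3) H4.
Qed.

Let rhoS a : -1 < a -> rho (1 + a) = rho a.
Proof.
move=> a1; rewrite /rho (addrC 1 a) ln_WS// (addrC a 1).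
have -> : b + 2 + (1 + a) = b + 2 + a + 1 by ring.
have -> : 1 + (1 + a) = 1 + a + 1 by ring.
have b2a : 0 < b + 2 + a by move: b1; lra.
have a10 : 0 < 1 + a by lra.
rewrite (lnGammaS b2a) (lnGammaS a10).
have -> : a + b + 2 = b + 2 + a by ring.
by ring.
Qed.

Let drhoS a : -1 < a -> drho (1 + a) = drho a.
Proof.
move=> a1; have a2 : -1 < 1 + a by lra.
have H1 := is_derive_translate (rho_derive a2).
have H2 : is_derive a 1 (fun a => rho (1 + a)) (drho a).
  by apply: is_derive_near a1 _ (rho_derive a1) => y y1; rewrite rhoS.
exact: is_derive_unique H1 H2.
Qed.

Let drho_shift n a : -1 < a -> drho (n%:R + a) = drho a.
Proof.
move=> a1; elim: n => [|n IH]; first by rewrite add0r.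
rewrite -[n.+1]add1n natrD -addrA drhoS ?IH//.
by have : 0 <= n%:R :> R by []; lra.
Qed.

(* Log-convexity pins each logarithmic derivative in [rho'] between two
   consecutive increments, which are logarithms of rational functions. *)
Let drho_bound a : 0 < a -> `|drho a| <= a^-1.
Proof.
move=> a0; have am1 : -1 < a - 1 by lra.
have am : -1 < a by lra.
have /andP[_] := psiW_bounds am1; rewrite ln_WS// !addrK subrK.
have /andP[+ _] := psiW_bounds am; rewrite ln_WS// addrK.
have b2 : 0 < b + 1 + a by move: b1; lra.
have /andP[_] := digam_bounds b2.
have b2' : 0 < b + 2 + a by move: b1; lra.
have /andP[+ _] := digam_bounds b2'.
have /andP[_] := digam_bounds a0.
have a10 : 0 < 1 + a by lra.
have /andP[+ _] := digam_bounds a10.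
have -> : b + 1 + a + 1 = b + 2 + a by ring.
have -> : a - 1 + b + 2 = b + 1 + a by ring.
have -> : a + b + 2 = b + 2 + a by ring.
rewrite [a + 1]addrC /drho.
(* The brackets for the three logarithmic derivatives add up to |drho a| <= ln (1 + a) - ln a: the
   terms in ln 2 and in b cancel. *)
have : ln (1 + a) <= ln a + a^-1.
  have -> : 1 + a = a * (1 + a^-1) by rewrite mulrDr mulr1 mulfV ?gt_eqF// addrC.
  rewrite lnM ?posrE ?addr_gt0 ?invr_gt0// lerD2l.
  by apply: le_ln1Dx; apply: (lt_trans (ltrN10 R)); rewrite invr_gt0.
move: (psiW a) (digam _) (digam _) (ln (1 + a)) (ln a) (ln (b + 2 + a))
  (ln (b + 1 + a)) (ln 2) (a^-1) => *.
by rewrite ler_norml; lra.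
Qed.

(** Periodicity moves the argument arbitrarily far to the right, where the bound 1 / a is as small
    as desired. *)
Let drho0 a : -1 < a -> drho a = 0.
Proof.
move=> a1; apply/eqP; rewrite -normr_le0; apply/ler_addgt0Pl => e e0.
have [n Hn] := invSS_lt e0.
(* One extra unit in the shift absorbs a, which may be negative but exceeds -1. *)
have n2 : n.+2%:R <= n.+3%:R + a.
  by rewrite -[n.+3]addn1 natrD; lra.
have n2' : 0 < n.+2%:R :> R by rewrite ltr0n.
rewrite addr0 -(drho_shift n.+3 a1) (le_trans (drho_bound _))//.
  exact: lt_le_trans n2.
apply: le_trans (ltW Hn); rewrite lef_pV2 ?posrE//.
exact: lt_le_trans n2.
Qed.

Lemma jacobi_integral1_Gamma a : -1 < a ->
  J 0 a b 1 * Gamma (a + b + 2) = 2 `^ (a + b + 1) * Gamma (a + 1) * Gamma (b + 1).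
Proof.
move=> a1; have b10 : 0 < b + 1 by move: b1; lra.
have N10 : -1 < 0 :> R by rewrite ltrN10.
have dr (x : R) : -1 < x -> is_derive x 1 rho 0.
  by move=> x1; rewrite -(drho0 x1); exact: rho_derive.
(* The constant is read off at a = 0, where the integral is elementary and Γ(1) = 1. *)
have := constant_right dr a1 N10.
rewrite /rho mul0r subr0 !addr0 Gamma1 ln1 subr0 jacobi_integral_base//.
have -> : b + 2 = b + 1 + 1 by ring.
rewrite lnGammaS// ln_div ?posrE ?powR_gt0// ln_powR.
have W0 := jacobi_integral1_gt0 a1 b1.
have G0 : 0 < Gamma (a + b + 2) by apply: Gamma_gt0; move: b1; lra.
have G1 : 0 < Gamma (a + 1) by apply: Gamma_gt0; lra.
have G2 : 0 < Gamma (b + 1) by apply: Gamma_gt0.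
have -> : b + 1 + 1 + a = a + b + 2 by ring.
rewrite [1 + a]addrC => H.
apply: ln_inj; rewrite ?posrE ?mulr_gt0 ?powR_gt0//.
rewrite !lnM ?posrE ?mulr_gt0 ?powR_gt0// ln_powR.
move: H; move: (ln (J _ _ _ _)) (ln (Gamma (a + b + 2))) (ln (Gamma (a + 1))).
move: (ln (Gamma (b + 1))) (ln (b + 1)) => u v w x y H.
have -> : w + x = (w + x - y - a * ln 2) + y + a * ln 2 by ring.
by rewrite H; ring.
Qed.

End fixed_b.

End beta_gamma.

(** * Jacobi polynomials *)

Section jacobi_polynomial.
Variable R : realType.
Implicit Types (x y a b : R) (p q : {poly R}).

Lemma pochhammerSr x k : pochhammer x k.+1 = pochhammer x k * (x + k%:R).
Proof. by rewrite /pochhammer big_ord_recr. Qed.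

Lemma pochhammerSl x k : pochhammer x k.+1 = x * pochhammer (x + 1) k.
Proof.
rewrite /pochhammer big_ord_recl addr0; congr (_ * _).
by apply: eq_bigr => i _; rewrite -[lift _ _ : nat]/(i.+1) -addrA -natr1 [1 + _]addrC.
Qed.

Lemma pochhammer0 x : pochhammer x 0 = 1.
Proof. by rewrite /pochhammer big_ord0. Qed.

Lemma pochhammer_gt0 x k : 0 < x -> 0 < pochhammer x k.
Proof.
by move=> x0; apply: prodr_gt0 => i _; rewrite ltr_wpDr.
Qed.

Definition jacobi_coef n a b l : R :=
  pochhammer (n%:R + a + b + 1) l * pochhammer (a + l%:R + 1) (n - l)
  / (l`!%:R * (n - l)`!%:R).

Definition jacobip n a b : {poly R} := \poly_(l < n.+1) jacobi_coef n a b l.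

Lemma jacobiE n a b x : jacobi n a b x = (jacobip n a b).[(x - 1) / 2].
Proof. by rewrite horner_poly. Qed.

Lemma size_jacobip n a b : (size (jacobip n a b) <= n.+1)%N.
Proof. exact: size_poly. Qed.

Lemma coef_jacobip n a b l : (l <= n)%N -> (jacobip n a b)`_l = jacobi_coef n a b l.
Proof. by move=> ln; rewrite coef_poly ltnS ln. Qed.

Lemma coef_jacobip_gt n a b l : (n < l)%N -> (jacobip n a b)`_l = 0.
Proof. by move=> nl; rewrite coef_poly ltnS leqNgt nl. Qed.

Lemma jacobip0 a b : jacobip 0 a b = 1.
Proof.
apply/polyP => -[|l]; last by rewrite coef_jacobip_gt// coef1.
by rewrite coef_jacobip// coef1 /jacobi_coef !pochhammer0 !fact0 !mulr1 divr1.
Qed.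

Definition jacobi_lead n a b : R := pochhammer (n%:R + a + b + 1) n / n`!%:R.

Lemma lead_jacobip n a b : (jacobip n a b)`_n = jacobi_lead n a b.
Proof.
by rewrite coef_jacobip// /jacobi_coef subnn pochhammer0 fact0 !mulr1.
Qed.

Lemma jacobi_lead_gt0 n a b : -1 < a + b + 1 -> 0 < jacobi_lead n a b.
Proof.
move=> s1; rewrite divr_gt0 ?ltr0n ?fact_gt0//; case: n => [|n].
  by rewrite pochhammer0.
by apply: pochhammer_gt0; have : 1 <= n.+1%:R :> R; [rewrite ler1n|lra].
Qed.

Let fact_neq0 n : n`!%:R != 0 :> R.
Proof. by rewrite pnatr_eq0 -lt0n fact_gt0. Qed.

Let factS n : n.+1`!%:R = n.+1%:R * n`!%:R :> R.
Proof. by rewrite factS natrM. Qed.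

Let natS_neq0 n : n.+1%:R != 0 :> R. Proof. by rewrite pnatr_eq0. Qed.

Let natS n : n.+1%:R = n%:R + 1 :> R. Proof. by rewrite natr1. Qed.

(** The eigenvalue equation read on the coefficient of y^l. Writing n as l + k + 1 keeps truncated
    subtraction out of the identity. *)
Lemma jacobi_coef_rec l k a b (n := (l + k.+1)%N) :
  l.+1%:R * (l%:R + a + 1) * jacobi_coef n a b l.+1 =
  k.+1%:R * (n%:R + l%:R + a + b + 1) * jacobi_coef n a b l.
Proof.
rewrite /jacobi_coef.
have -> : (n - l.+1 = k)%N by rewrite /n; lia.
have -> : (n - l = k.+1)%N by rewrite /n; lia.
rewrite !factS pochhammerSr (pochhammerSl (a + l%:R + 1)).
have -> : a + l.+1%:R + 1 = a + l%:R + 1 + 1 by rewrite natS; ring.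
move: (pochhammer _ l) (pochhammer _ k) => u v.
by field; rewrite ?natr1 ?nat1r ?natS_neq0 ?fact_neq0.
Qed.

Lemma jacobi_coef_deriv n l a b :
  l.+1%:R * jacobi_coef n.+1 a b l.+1 =
  (n.+1%:R + a + b + 1) * jacobi_coef n (a + 1) (b + 1) l.
Proof.
rewrite /jacobi_coef subSS pochhammerSl factS.
have -> : n%:R + (a + 1) + (b + 1) + 1 = n.+1%:R + a + b + 1 + 1 by rewrite natS; ring.
have -> : a + 1 + l%:R + 1 = a + l.+1%:R + 1 by rewrite natS; ring.
move: (pochhammer _ l) (pochhammer _ (n - l)) => u v.
by field; rewrite ?natr1 ?nat1r ?natS_neq0 ?fact_neq0.
Qed.

Lemma jacobi_coef_eigen l k a b (n := (l + k)%N) :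
  l.+1%:R * jacobi_coef n.+1 a b l.+1 - k.+1%:R * jacobi_coef n.+1 a b l =
  (n.+1%:R + b) * jacobi_coef n (a + 1) b l.
Proof.
rewrite /jacobi_coef subSS /n -addnS !addKn pochhammerSr (pochhammerSl (a + l%:R + 1)) !factS.
have -> : (l + k)%:R + (a + 1) + b + 1 = (l + k.+1)%:R + a + b + 1 :> R.
  by rewrite addnS natS; ring.
have -> : a + 1 + l%:R + 1 = a + l.+1%:R + 1 by rewrite natS; ring.
have -> : a + l%:R + 1 + 1 = a + l.+1%:R + 1 by rewrite natS; ring.
move: (pochhammer _ l) (pochhammer _ k) => u v.
rewrite natrD !natS.
by field; rewrite ?natr1 ?nat1r ?natS_neq0 ?fact_neq0.
Qed.

Lemma jacobi_coef_contiguous l k a b (n := (l + k)%N) :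
  (2 * n.+1%:R + a + b + 1) * jacobi_coef n.+1 a b l =
  (n.+1%:R + a + b + 1) * jacobi_coef n.+1 (a + 1) b l -
  (n.+1%:R + b) * jacobi_coef n (a + 1) b l.
Proof.
rewrite /jacobi_coef /n -addnS !addKn (pochhammerSl (a + l%:R + 1)) !factS.
have -> : (l + k)%:R + (a + 1) + b + 1 = (l + k.+1)%:R + a + b + 1 :> R.
  by rewrite addnS natS; ring.
have E := pochhammerSl ((l + k.+1)%:R + a + b + 1) l; rewrite pochhammerSr in E.
have -> : (l + k.+1)%:R + (a + 1) + b + 1 = (l + k.+1)%:R + a + b + 1 + 1 :> R by ring.
have -> : a + 1 + l%:R + 1 = a + l%:R + 1 + 1 by ring.
rewrite pochhammerSr !mulrA -E.
move: (pochhammer _ l) (pochhammer _ k) => u v.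
rewrite natrD !natS.
by field; rewrite ?natr1 ?nat1r ?natS_neq0 ?fact_neq0.
Qed.

Lemma jacobi_coef_contiguous_top n a b :
  (2 * n.+1%:R + a + b + 1) * jacobi_coef n.+1 a b n.+1 =
  (n.+1%:R + a + b + 1) * jacobi_coef n.+1 (a + 1) b n.+1.
Proof.
rewrite /jacobi_coef subnn !pochhammer0 fact0 !mulr1.
have E := pochhammerSl (n.+1%:R + a + b + 1) n.+1; rewrite pochhammerSr in E.
have -> : n.+1%:R + (a + 1) + b + 1 = n.+1%:R + a + b + 1 + 1 by ring.
by rewrite mulrA mulrA -E; ring.
Qed.

(** The Jacobi differential operator in the variable y, with its sign reversed so that the
    eigenvalue on degree n is n (n + a + b + 1). It is bidiagonal on monomials. *)
Definition jacobi_op a b p : {poly R} :=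
  'X * ('X + 1) * p^`()^`() + ((a + 1)%:P + (a + b + 2) *: 'X) * p^`().

Lemma coef_jacobi_op a b p l : (jacobi_op a b p)`_l =
  l%:R * (l%:R + a + b + 1) * p`_l + l.+1%:R * (l%:R + a + 1) * p`_l.+1.
Proof.
rewrite /jacobi_op -mulrA mulrDl mul1r mulrDl -scalerAl mul_polyC !coefD !coefZ.
rewrite !coefXM coefD coefXM.
have D (q : {poly R}) i : q^`()`_i = i.+1%:R * q`_i.+1 by rewrite coef_deriv mulr_natl.
case: l => [|[|l]] /=; rewrite !D ?natS; ring.
Qed.

Lemma jacobi_op_eigen n a b :
  jacobi_op a b (jacobip n a b) = (n%:R * (n%:R + a + b + 1)) *: jacobip n a b.
Proof.
apply/polyP => l; rewrite coef_jacobi_op coefZ.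
have [nl|ln|->] := ltngtP n l; last by rewrite (coef_jacobip_gt _ _ (ltnSn _)); ring.
  by rewrite (coef_jacobip_gt _ _ nl) (coef_jacobip_gt _ _ (leqW nl)); ring.
rewrite !coef_jacobip// ?(ltnW ln)//.
have [k nE] : exists k, n = (l + k.+1)%N.
  by exists (n - l).-1; rewrite prednK ?subn_gt0// subnKC// ltnW.
subst n.
by rewrite jacobi_coef_rec natrD; ring.
Qed.

Lemma deriv_jacobip n a b :
  (jacobip n.+1 a b)^`() = (n.+1%:R + a + b + 1) *: jacobip n (a + 1) (b + 1).
Proof.
apply/polyP => l; rewrite coef_deriv coefZ -[_ *+ _]mulr_natl.
have [ln|nl] := leqP l n; last by rewrite !coef_jacobip_gt// !mulr0.
by rewrite !coef_jacobip// jacobi_coef_deriv.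
Qed.

Lemma jacobip_lower n a b :
  ('X + 1) * (jacobip n.+1 a b)^`() - n.+1%:R *: jacobip n.+1 a b =
  (n.+1%:R + b) *: jacobip n (a + 1) b.
Proof.
apply/polyP => l; rewrite mulrDl mul1r coefB coefD !coefZ coefXM.
have D i : (jacobip n.+1 a b)^`()`_i = i.+1%:R * (jacobip n.+1 a b)`_i.+1.
  by rewrite coef_deriv mulr_natl.
rewrite !D.
have -> : (if l == 0%N then 0 else l.-1.+1%:R * (jacobip n.+1 a b)`_l.-1.+1) =
  l%:R * (jacobip n.+1 a b)`_l by case: l => [|l] /=; rewrite ?mul0r.
have [ln|nl|->] := ltngtP l n.+1; last 2 first.
- rewrite !(coef_jacobip_gt _ _ nl, coef_jacobip_gt _ _ (leqW nl)).
  by rewrite !(coef_jacobip_gt _ _ (ltnW nl)); ring.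
- by rewrite (coef_jacobip_gt _ _ (ltnSn _)) (coef_jacobip_gt _ _ (ltnSn _)); ring.
rewrite !coef_jacobip ?(ltnW ln)//.
have := jacobi_coef_eigen l (n - l) a b; rewrite subnKC// => <-.
by rewrite -subSn// natrB; [ring|exact: ltnW].
Qed.

Lemma jacobip_contiguous n a b :
  (2 * n.+1%:R + a + b + 1) *: jacobip n.+1 a b =
  (n.+1%:R + a + b + 1) *: jacobip n.+1 (a + 1) b -
  (n.+1%:R + b) *: jacobip n (a + 1) b.
Proof.
apply/polyP => l; rewrite coefB !coefZ.
have [ln|nl|->] := ltngtP l n.+1; last 2 first.
- rewrite !(coef_jacobip_gt _ _ nl, coef_jacobip_gt _ _ (leqW nl)).
  by rewrite !(coef_jacobip_gt _ _ (ltnW nl)); ring.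
- rewrite (coef_jacobip_gt _ _ (ltnSn _)) !coef_jacobip//.
  by rewrite jacobi_coef_contiguous_top mulr0 subr0.
rewrite !coef_jacobip ?(ltnW ln)//.
by have := jacobi_coef_contiguous l (n - l) a b; rewrite subnKC.
Qed.

(* An eigenvector is determined by its leading coefficient, the other ones
   being computed from the top down. *)
Lemma jacobi_op_eigen0 n a b p : -1 < a + b + 1 -> (size p <= n.+1)%N ->
  jacobi_op a b p = (n%:R * (n%:R + a + b + 1)) *: p -> p`_n = 0 -> p = 0.
Proof.
move=> s1 sp Tp pn; apply/polyP => l; rewrite coef0.
have [nl|ln] := ltnP n l; first by rewrite nth_default// (leq_trans sp).
rewrite -(subKn ln); move: (n - l)%N => {l ln} k.
elim: k => [|k IH]; first by rewrite subn0.
have [kn|nk] := ltnP k n; last first.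
  by rewrite (_ : (n - k.+1 = n - k)%N)//; lia.
have := congr1 (fun q : {poly R} => q`_(n - k.+1)) Tp.
rewrite coef_jacobi_op coefZ -subSn// subSS IH mulr0 addr0.
set l := (n - k.+1)%N; have ln : (l < n)%N by rewrite /l; lia.
move/eqP; rewrite -subr_eq0 -mulrBl mulf_eq0 => /orP[|/eqP//].
rewrite (_ : _ - _ = (l%:R - n%:R) * (n%:R + l%:R + (a + b + 1))); last by ring.
rewrite mulf_eq0 subr_eq0 eqr_nat (ltn_eqF ln)/= gt_eqF//.
have : 1 <= n%:R :> R by rewrite ler1n (leq_ltn_trans _ ln).
have : 0 <= l%:R :> R by [].
by lra.
Qed.

End jacobi_polynomial.

(** * Connection formulas, orthogonality and norms *)

Section orthogonality.
Variable R : realType.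
Implicit Types (x y a b s : R) (p q : {poly R}).

Local Notation J := (@jacobi_integral R).

Definition connection_coef m k a b : R :=
  Gamma (m%:R + b + 1) / Gamma (m%:R + a + b + 2) *
  (Gamma_mul k (a + b + 1) / Gamma (k%:R + b + 1)).

(** Induction with the contiguous relation. Passing from m to m + 1 multiplies all earlier
    coefficients by the common factor (m + b + 1) / (m + a + b + 2), which is why they split into a
    function of m times a function of k. *)
Lemma jacobip_connection m a b : -1 < a -> -1 < b ->
  jacobip m (a + 1) b = \sum_(k < m.+1) connection_coef m k a b *: jacobip k a b.
Proof.
move=> a1 b1; have s1 : -1 < a + b + 1 by lra.
have Gb (k : nat) : 0 < Gamma (k%:R + b + 1).
  by apply: Gamma_gt0; have : 0 <= k%:R :> R by []; lra.
have Gs (k : nat) : 0 < Gamma (k%:R + a + b + 2).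
  by apply: Gamma_gt0; have : 0 <= k%:R :> R by []; lra.
elim: m => [|m IH].
  rewrite big_ord_recl big_ord0 addr0 !jacobip0 /connection_coef Gamma_mulE//.
  rewrite -[LHS]scale1r; congr (_ *: _).
  have := Gs 0%N; have := Gb 0%N; rewrite /= mulr0n !add0r.
  have -> : 1 + (a + b + 1) = a + b + 2 by ring.
  by move=> *; field; rewrite !gt_eqF.
have m0 : 0 <= m%:R :> R by [].
have ms : 0 < m.+1%:R + a + b + 1 by rewrite -natr1; lra.
have mb : 0 < m%:R + b + 1 by lra.
apply: (scalerI (lt0r_neq0 ms)).
have -> : (m.+1%:R + a + b + 1) *: jacobip m.+1 (a + 1) b =
  (2 * m.+1%:R + a + b + 1) *: jacobip m.+1 a b + (m.+1%:R + b) *: jacobip m (a + 1) b.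
  by rewrite jacobip_contiguous subrK.
rewrite big_ord_recr/= scalerDr addrC IH !scaler_sumr scalerA; congr (_ + _).
  apply: eq_bigr => k _; rewrite !scalerA; congr (_ *: _).
  rewrite /connection_coef -natr1.
  have -> : m%:R + 1 + b + 1 = m%:R + b + 1 + 1 by ring.
  have -> : m%:R + 1 + a + b + 2 = m%:R + a + b + 2 + 1 by ring.
  have ms2 : 0 < m%:R + a + b + 2 by lra.
  rewrite (GammaS mb) (GammaS ms2).
  move: (Gs m) (Gb k) => H1 H2; field.
  by rewrite !gt_eqF//=; lra.
congr (_ *: _); rewrite /connection_coef Gamma_mulE//.
have -> : m.+1%:R + a + b + 2 = m.+1%:R + (a + b + 1) + 1 by ring.
have ms' : 0 < m.+1%:R + (a + b + 1) by rewrite !addrA.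
rewrite (GammaS ms'); move: (Gb m.+1) (Gamma_gt0 ms') => H1 H2; field.
by rewrite !gt_eqF//=; move: ms'; lra.
Qed.

Definition lowering_coef n k a b : R :=
  Gamma (n%:R + b + 1) / Gamma (n%:R + a + b + 1) *
  (Gamma_mul k (a + b + 1) / Gamma (k%:R + b + 1)).

Lemma jacobip_lowering n a b : -1 < a -> -1 < b ->
  ('X + 1) * (jacobip n a b)^`() - n%:R *: jacobip n a b =
  \sum_(k < n) lowering_coef n k a b *: jacobip k a b.
Proof.
move=> a1 b1; case: n => [|n].
  by rewrite big_ord0 jacobip0 -[1]/(1%:P) derivC mulr0 scale0r subr0.
rewrite jacobip_lower jacobip_connection// scaler_sumr; apply: eq_bigr => k _.
rewrite scalerA; congr (_ *: _); rewrite /connection_coef /lowering_coef.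
rewrite [LHS]mulrA; congr (_ * _); rewrite mulrA; congr (_ / _).
  have n0 : 0 <= n%:R :> R by [].
  have -> : n.+1%:R + b = n%:R + b + 1 by rewrite -natr1; ring.
  by rewrite -GammaS; [congr Gamma; rewrite -natr1; ring|lra].
by congr Gamma; rewrite -natr1; ring.
Qed.

Lemma jacobi_opD a b p q : jacobi_op a b (p + q) = jacobi_op a b p + jacobi_op a b q.
Proof. by rewrite /jacobi_op !derivD; ring. Qed.

Lemma jacobi_op_sub a b p q : jacobi_op a b (p - q) = jacobi_op a b p - jacobi_op a b q.
Proof. by rewrite /jacobi_op !derivB; ring. Qed.

Lemma jacobi_opZ a b c p : jacobi_op a b (c *: p) = c *: jacobi_op a b p.
Proof. by rewrite /jacobi_op !derivZ scalerDr !scalerAr. Qed.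

Lemma jacobi_op_sum a b n (c : nat -> R) (p : nat -> {poly R}) :
  jacobi_op a b (\sum_(k < n) c k *: p k) = \sum_(k < n) c k *: jacobi_op a b (p k).
Proof.
elim: n => [|n IH]; first by rewrite !big_ord0 /jacobi_op !deriv0 !mulr0 addr0.
by rewrite !big_ord_recr/= jacobi_opD jacobi_opZ IH.
Qed.

Section fixed_parameters.
Variables a b : R.
Hypotheses (a1 : -1 < a) (b1 : -1 < b).

Let s1 : -1 < a + b + 1. Proof. by move: a1 b1; lra. Qed.

Lemma jacobi_integralB j p q : J j a b (p - q) = J j a b p - J j a b q.
Proof. by rewrite jacobi_integralD// -scaleN1r jacobi_integralZ// mulN1r. Qed.

Lemma jacobi_integral0 j : J j a b 0 = 0.
Proof. by rewrite -(scale0r (0 : {poly R})) jacobi_integralZ// mul0r. Qed.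

Lemma jacobi_integral_sum j n (c : nat -> R) (p : nat -> {poly R}) :
  J j a b (\sum_(k < n) c k *: p k) = \sum_(k < n) c k * J j a b (p k).
Proof.
elim: n => [|n IH]; first by rewrite !big_ord0 jacobi_integral0.
by rewrite !big_ord_recr/= jacobi_integralD// IH jacobi_integralZ.
Qed.

(** The difference of the two sides is the integration-by-parts identity for the Wronskian p' q - q'
    p. *)
Lemma jacobi_op_sym p q : J 0 a b (jacobi_op a b p * q) = J 0 a b (jacobi_op a b q * p).
Proof.
apply/eqP; rewrite -subr_eq0 -jacobi_integralB.
rewrite -(jacobi_integral_pearson (p^`() * q - q^`() * p) a1 b1).
apply/eqP; congr (J _ _ _ _); rewrite /jacobi_op derivB !derivM.
by move: ((a + 1)%:P) ((a + b + 2) *: 'X) (p^`()) (q^`()) (p^`()^`()) (q^`()^`()) => *; ring.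
Qed.

(** The same identity applied to p' p. As y (y + 1) = - (1 - x^2) / 4, the right-hand side is a norm
    of p' for the weight with both parameters raised by 1. *)
Lemma jacobi_op_energy p :
  J 0 a b (jacobi_op a b p * p) = - J 0 a b ('X * ('X + 1) * (p^`() * p^`())).
Proof.
apply/eqP; rewrite -subr_eq0 opprK -jacobi_integralD//.
rewrite -(jacobi_integral_pearson (p^`() * p) a1 b1).
apply/eqP; congr (J _ _ _ _); rewrite /jacobi_op derivM.
by move: ((a + 1)%:P) ((a + b + 2) *: 'X) (p^`()) (p^`()^`()) => *; ring.
Qed.

Lemma jacobip_orthogonal n m : n != m -> J 0 a b (jacobip n a b * jacobip m a b) = 0.
Proof.
wlog nm : n m / (n < m)%N => [H|_].
  by rewrite neq_ltn => /orP[] nm; [|rewrite mulrC]; apply: H; rewrite // ltn_eqF.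
have := jacobi_op_sym (jacobip n a b) (jacobip m a b).
rewrite !jacobi_op_eigen -!scalerAl !jacobi_integralZ// [jacobip m a b * _]mulrC.
move/eqP; rewrite -subr_eq0 -mulrBl mulf_eq0 => /orP[|/eqP//].
rewrite (_ : _ - _ = (n%:R - m%:R) * (m%:R + n%:R + (a + b + 1))); last by ring.
rewrite mulf_eq0 subr_eq0 eqr_nat (ltn_eqF nm)/= gt_eqF//.
have : 1 <= m%:R :> R by rewrite ler1n (leq_ltn_trans _ nm).
have : 0 <= n%:R :> R by [].
by move: s1; lra.
Qed.

End fixed_parameters.

Definition jacobi_sqnorm n a b : R :=
  2 `^ (a + b + 1) * Gamma (n%:R + a + 1) * Gamma (n%:R + b + 1) /
  (n`!%:R * Gamma_mul n (a + b + 1)).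

Lemma jacobi_sqnorm_gt0 n a b : -1 < a -> -1 < b -> 0 < jacobi_sqnorm n a b.
Proof.
move=> a1 b1; have n0 : 0 <= n%:R :> R by [].
have G1 : 0 < Gamma (n%:R + a + 1) by apply: Gamma_gt0; lra.
have G2 : 0 < Gamma (n%:R + b + 1) by apply: Gamma_gt0; lra.
have G3 : 0 < Gamma_mul n (a + b + 1) by apply: Gamma_mul_gt0; lra.
by rewrite divr_gt0 ?mulr_gt0 ?powR_gt0// ltr0n fact_gt0.
Qed.

(** Induction on n for all parameters at once: the derivative of the polynomial of degree n + 1 is a
    multiple of the one of degree n for (a + 1, b + 1), and the energy identity divided by the
    eigenvalue transfers the norm. *)
Lemma jacobip_sqnorm n a b : -1 < a -> -1 < b ->
  J 0 a b (jacobip n a b * jacobip n a b) = jacobi_sqnorm n a b.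
Proof.
elim: n a b => [|n IH] a b a1 b1; have s1 : -1 < a + b + 1 by lra.
  rewrite jacobip0 mulr1 /jacobi_sqnorm Gamma_mulE// fact0 mul1r !add0r.
  have -> : 1 + (a + b + 1) = a + b + 2 by ring.
  have G0 : 0 < Gamma (a + b + 2) by apply: Gamma_gt0; lra.
  by rewrite -jacobi_integral1_Gamma// mulfK// gt_eqF.
have n0 : 0 <= n%:R :> R by [].
have := jacobi_op_energy a1 b1 (jacobip n.+1 a b).
rewrite jacobi_op_eigen -scalerAl jacobi_integralZ// deriv_jacobip.
have a2 : -1 < a + 1 by lra.
have b2 : -1 < b + 1 by lra.
have := IH _ _ a2 b2.
set K := jacobip n (a + 1) (b + 1).
rewrite jacobi_integralSl jacobi_integralSr.
rewrite (_ : 2 *: _ * _ = - 4 *: ('X * ('X + 1) * (K * K))); last first.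
  rewrite -!scalerAl -!scalerAr scalerA (_ : 2 * - 2 = - 4); last by ring.
  by congr (_ *: _); ring.
rewrite jacobi_integralZ// => IHn.
rewrite (_ : 'X * _ * (_ * _) =
  (n.+1%:R + a + b + 1) ^+ 2 *: ('X * ('X + 1) * (K * K))); last first.
  by rewrite -!scalerAl -!scalerAr !scalerA expr2.
rewrite jacobi_integralZ//.
have -> : J 0 a b ('X * ('X + 1) * (K * K)) = - jacobi_sqnorm n (a + 1) (b + 1) / 4.
  by rewrite -IHn; field.
rewrite /jacobi_sqnorm.
have -> : a + 1 + (b + 1) + 1 = a + b + 1 + 2 by ring.
rewrite Gamma_mulS// powRD ?pnatr_eq0 ?implybT// (@powR_mulrn _ 2 2)//.
rewrite factS natrM -natr1.
have -> : n%:R + 1 + a + 1 = n%:R + (a + 1) + 1 by ring.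
have -> : n%:R + 1 + b + 1 = n%:R + (b + 1) + 1 by ring.
have G3 : Gamma_mul n.+1 (a + b + 1) != 0 by rewrite gt_eqF// Gamma_mul_gt0.
have f0 : n`!%:R != 0 :> R by rewrite pnatr_eq0 -lt0n fact_gt0.
have n1 : n%:R + 1 != 0 :> R by rewrite gt_eqF//; lra.
have ns : n%:R + a + b + 2 != 0 by rewrite gt_eqF//; lra.
move=> H; apply: (mulfI (_ : (n%:R + 1) * (n%:R + 1 + a + b + 1) != 0)).
  by rewrite mulf_neq0// gt_eqF//; lra.
rewrite H; field.
by rewrite f0 G3 n1 gt_eqF//; lra.
Qed.

Lemma jacobi_norm_sqr n a b : -1 < a -> -1 < b ->
  jacobi_norm n a b ^+ 2 = jacobi_sqnorm n a b.
Proof. by move=> a1 b1; rewrite sqr_sqrtr// ltW// jacobi_sqnorm_gt0. Qed.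

Lemma jacobi_norm_gt0 n a b : -1 < a -> -1 < b -> 0 < jacobi_norm n a b.
Proof. by move=> a1 b1; rewrite sqrtr_gt0 jacobi_sqnorm_gt0. Qed.

Definition ojacobip n a b : {poly R} := (jacobi_norm n a b)^-1 *: jacobip n a b.

Lemma ojacobiE n a b x : ojacobi n a b x = (ojacobip n a b).[(x - 1) / 2].
Proof. by rewrite /ojacobi jacobiE hornerZ mulrC. Qed.

Lemma ojacobip_orthonormal n m a b : -1 < a -> -1 < b ->
  J 0 a b (ojacobip n a b * ojacobip m a b) = (n == m)%:R.
Proof.
move=> a1 b1; rewrite -scalerAl -scalerAr !jacobi_integralZ//.
have [<-|nm] := eqVneq n m; last by rewrite jacobip_orthogonal// !mulr0.
rewrite jacobip_sqnorm// -jacobi_norm_sqr// -[RHS]/(1 : R); field.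
by rewrite gt_eqF// jacobi_norm_gt0.
Qed.

End orthogonality.

(** * Differentiation with respect to a parameter *)

Section polynomial_paths.
Variable R : realType.
Implicit Types (a b y : R) (p dp : R -> {poly R}).

Lemma is_derive_shifted (f g : R -> R) (c x df : R) : (forall y, g y = c + y) ->
  is_derive (g x) 1 f df -> is_derive x 1 (fun y => f (g y)) df.
Proof.
move=> gE; rewrite gE => H.
have -> : (fun y => f (g y)) = (fun y => f (c + y)) by apply/funext => y; rewrite gE.
exact: is_derive_translate.
Qed.

Lemma is_derive_horner_path p (dq : {poly R}) a y N :
  (forall a', size (p a') <= N)%N -> (size dq <= N)%N ->
  (forall l, is_derive a 1 (fun a' => (p a')`_l) dq`_l) ->
  is_derive a 1 (fun a' => (p a').[y]) dq.[y].
Proof.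
move=> sp sq dp.
have -> : (fun a' => (p a').[y]) = (fun a' => \sum_(l < N) (p a')`_l * y ^+ l).
  by apply/funext => a'; rewrite (horner_coef_wide _ (sp a')).
rewrite (horner_coef_wide _ sq).
apply: (@is_derive_bigsum _ N (fun l a' => (p a')`_l * y ^+ l) a
  (fun l => dq`_l * y ^+ l)) => l _.
have := is_derive_mul (dp l) (is_derive_cst (y ^+ l) a 1).
by rewrite mulr0 addr0.
Qed.

(** Both the weight and the polynomial move with a. Expanding in monomials, with a degree bound
    uniform in a, reduces this to a finite sum of products of a coefficient and the integral of a
    fixed monomial. *)
Lemma is_derive_jacobi_integral_path j p (dq : {poly R}) a b N :
  -1 < a -> -1 < b ->
  (forall a', size (p a') <= N)%N -> (size dq <= N)%N ->
  (forall l, is_derive a 1 (fun a' => (p a')`_l) dq`_l) ->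
  is_derive a 1 (fun a' => jacobi_integral j a' b (p a'))
    (jacobi_integral j.+1 a b (p a) + jacobi_integral j a b dq).
Proof.
move=> a1 b1 sp sq dp.
have JE i a' (q : {poly R}) : -1 < a' -> (size q <= N)%N ->
    jacobi_integral i a' b q = \sum_(l < N) q`_l * jacobi_integral i a' b 'X^l.
  move=> a1' sqN; rewrite -(@jacobi_integral_sum _ _ _ a1' b1 _ _ _ (fun l => 'X^l)).
  congr jacobi_integral; apply/polyP => i'; rewrite coef_sum.
  have [iN|Ni] := ltnP i' N; last first.
    rewrite nth_default ?(leq_trans sqN)// big1// => k _.
    by rewrite coefZ coefXn gtn_eqF ?mulr0// (leq_trans _ Ni).
  rewrite (bigD1 (Ordinal iN))//= coefZ coefXn eqxx mulr1 big1 ?addr0// => k.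
  by rewrite -val_eqE/= eq_sym coefZ coefXn => /negbTE ->; rewrite mulr0.
apply: (@is_derive_near _ _
  (fun a' => \sum_(l < N) (p a')`_l * jacobi_integral j a' b 'X^l) _ _ _ a1).
  by move=> a' a1'; rewrite JE.
rewrite !JE// -big_split/=.
have H := @is_derive_bigsum _ N
  (fun l a' => (p a')`_l * jacobi_integral j a' b 'X^l) a _
  (fun l _ => is_derive_mul (dp l) (is_derive_jacobi_integral j 'X^l a1 b1)).
apply: is_derive_eq H _.
by apply: eq_bigr => l _; rewrite addrC.
Qed.

End polynomial_paths.

Section parameter_derivative.
Variable R : realType.
Implicit Types (x y a b s : R).

(** Existence suffices: the derivative of a Jacobi polynomial is later identified by its
    differential equation and its leading coefficient. *)
Lemma ex_derive_pochhammer x k :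
  exists d, is_derive x 1 (fun x => pochhammer x k) d.
Proof.
elim: k => [|k [d Hd]].
  exists 0; have -> : (fun x : R => pochhammer x 0) = cst 1.
    by apply/funext => y; rewrite pochhammer0.
  exact: is_derive_cst.
exists (d * (x + k%:R) + pochhammer x k * (1 + 0)).
have -> : (fun x : R => pochhammer x k.+1) = (fun x => pochhammer x k * (x + k%:R)).
  by apply/funext => y; rewrite pochhammerSr.
exact: is_derive_mul.
Qed.

Definition djacobi_coef n a b l : R := derive1 (fun a => (jacobip n a b)`_l) a.

Lemma is_derive_jacobip_coef n a b l :
  is_derive a 1 (fun a => (jacobip n a b)`_l) (djacobi_coef n a b l).
Proof.
suff [d Hd] : exists d, is_derive a 1 (fun a => (jacobip n a b)`_l) d.
  by rewrite /djacobi_coef (is_derive_derive1 Hd).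
have [ln|nl] := leqP l n; last first.
  exists 0; have -> : (fun a => (jacobip n a b)`_l) = cst 0.
    by apply/funext => y; rewrite coef_jacobip_gt.
  exact: is_derive_cst.
have [d1 H1] := ex_derive_pochhammer (n%:R + a + b + 1) l.
have [d2 H2] := ex_derive_pochhammer (a + l%:R + 1) (n - l).
pose c : R := (l`!%:R * (n - l)`!%:R)^-1.
exists (c * (d1 * pochhammer (a + l%:R + 1) (n - l) +
             pochhammer (n%:R + a + b + 1) l * d2)).
have -> : (fun a => (jacobip n a b)`_l) = (fun a =>
    c * (pochhammer (n%:R + a + b + 1) l * pochhammer (a + l%:R + 1) (n - l))).
  by apply/funext => y; rewrite coef_jacobip// /jacobi_coef mulrC.
apply: is_derive_scale; apply: is_derive_mul.
  apply: (@is_derive_shifted _ (fun x => pochhammer x l)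
    (fun a => n%:R + a + b + 1) (n%:R + b + 1)) => // y; ring.
apply: (@is_derive_shifted _ (fun x => pochhammer x (n - l))
  (fun a => a + l%:R + 1) (l%:R + 1)) => // y; ring.
Qed.

Lemma djacobi_coef_gt n a b l : (n < l)%N -> djacobi_coef n a b l = 0.
Proof.
move=> nl; apply: is_derive_derive1.
have -> : (fun a => (jacobip n a b)`_l) = cst 0.
  by apply/funext => y; rewrite coef_jacobip_gt.
exact: is_derive_cst.
Qed.

Definition djacobip n a b : {poly R} := \poly_(l < n.+1) djacobi_coef n a b l.

Lemma coef_djacobip n a b l : (djacobip n a b)`_l = djacobi_coef n a b l.
Proof.
by rewrite coef_poly; case: ltnP => // nl; rewrite djacobi_coef_gt.
Qed.

(* The eigenvalue equation differentiated with respect to [a]. *)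
Lemma djacobip_ode n a b :
  (n%:R * (n%:R + a + b + 1)) *: djacobip n a b - jacobi_op a b (djacobip n a b) =
  ('X + 1) * (jacobip n a b)^`() - n%:R *: jacobip n a b.
Proof.
apply/polyP => l; rewrite !coefB !coefZ coef_jacobi_op !coef_djacobip.
rewrite mulrDl mul1r coefD coefXM.
have D i : (jacobip n a b)^`()`_i = i.+1%:R * (jacobip n a b)`_i.+1.
  by rewrite coef_deriv mulr_natl.
rewrite !D.
have -> : (if l == 0%N then 0 else l.-1.+1%:R * (jacobip n a b)`_l.-1.+1) =
  l%:R * (jacobip n a b)`_l by case: l => [|l] /=; rewrite ?mul0r.
have dl := is_derive_jacobip_coef n a b l.
have dl1 := is_derive_jacobip_coef n a b l.+1.
have daff c1 c2 : is_derive a 1 (fun a : R => c1 * (c2 + a)) c1.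
  have := is_derive_scale c1 (is_derive_add (is_derive_cst c2 a 1) (is_derive_id a 1)).
  by rewrite add0r mulr1.
have H1 := is_derive_add (is_derive_mul (daff l%:R (l%:R + b + 1)) dl)
  (is_derive_mul (daff l.+1%:R (l%:R + 1)) dl1).
have H2 := is_derive_mul (daff n%:R (n%:R + b + 1)) dl.
have E : (fun y => l%:R * (l%:R + b + 1 + y) * (jacobip n y b)`_l +
    l.+1%:R * (l%:R + 1 + y) * (jacobip n y b)`_l.+1) =
    (fun y => n%:R * (n%:R + b + 1 + y) * (jacobip n y b)`_l).
  apply/funext => y.
  have := congr1 (fun q : {poly R} => q`_l) (jacobi_op_eigen n y b).
  rewrite coef_jacobi_op coefZ.
  have -> : l%:R + b + 1 + y = l%:R + y + b + 1 by ring.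
  have -> : l%:R + 1 + y = l%:R + y + 1 by ring.
  by have -> : n%:R + b + 1 + y = n%:R + y + b + 1 by ring.
rewrite E in H1.
have := is_derive_unique H1 H2.
move: (djacobi_coef n a b l) (djacobi_coef n a b l.+1) => q q1.
move: ((jacobip n a b)`_l) ((jacobip n a b)`_l.+1) => p p1 H.
apply/eqP; rewrite -subr_eq0.
rewrite (_ : _ - _ = (n%:R * p + n%:R * (n%:R + b + 1 + a) * q) -
  (l%:R * p + l%:R * (l%:R + b + 1 + a) * q +
  (l.+1%:R * p1 + l.+1%:R * (l%:R + 1 + a) * q1))); last by ring.
by rewrite -H subrr.
Qed.

(** The denominator is the difference n (n + s) - k (k + s) of the eigenvalues, where s = a + b +
    1. *)
Definition froehlich_coef n k a b : R :=
  lowering_coef n k a b / ((n%:R - k%:R) * (n%:R + k%:R + a + b + 1)).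

(** Both sides solve the same inhomogeneous eigenvalue equation and have the same coefficient of
    degree n, so their difference is an eigenvector without leading term. *)
Lemma djacobip_expansion n a b : -1 < a -> -1 < b ->
  djacobip n a b = \sum_(k < n) froehlich_coef n k a b *: jacobip k a b +
    (djacobi_coef n a b n / jacobi_lead n a b) *: jacobip n a b.
Proof.
move=> a1 b1; have s1 : -1 < a + b + 1 by lra.
set r := RHS; apply/eqP; rewrite -subr_eq0; apply/eqP.
have sr : (size r <= n.+1)%N.
  rewrite (leq_trans (size_polyD _ _))// geq_max; apply/andP; split.
    apply: (leq_trans (size_sum _ _ _)); apply/bigmax_leqP => k _.
    rewrite (leq_trans (size_scale_leq _ _))// (leq_trans (size_jacobip _ _ _))//.
    by rewrite ltnS ltnW.
  by rewrite (leq_trans (size_scale_leq _ _))// size_jacobip.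
apply: (@jacobi_op_eigen0 _ n a b) => //.
- rewrite (leq_trans (size_polyD _ _))// size_polyN geq_max sr andbT.
  exact: size_poly.
- have Er : (n%:R * (n%:R + a + b + 1)) *: r - jacobi_op a b r =
      ('X + 1) * (jacobip n a b)^`() - n%:R *: jacobip n a b.
    rewrite jacobip_lowering// /r jacobi_opD jacobi_opZ jacobi_op_eigen.
    rewrite (jacobi_op_sum a b n (fun k => froehlich_coef n k a b) (fun k => jacobip k a b)).
    rewrite scalerDr opprD addrACA !scalerA [X in X *: jacobip n a b]mulrC subrr addr0.
    rewrite scaler_sumr -sumrB; apply: eq_bigr => k _.
    rewrite jacobi_op_eigen !scalerA -scalerBl; congr (_ *: _).
    rewrite /froehlich_coef; have kn := ltn_ord k.
    have H1 : n%:R - k%:R != 0 :> R by rewrite subr_eq0 eqr_nat gtn_eqF.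
    (* As k < n, n is at least 1, which outweighs a + b + 1 > -1. *)
    have H2 : n%:R + k%:R + a + b + 1 != 0.
      rewrite gt_eqF//; have : 0 <= k%:R :> R by [].
      have : 1 <= n%:R :> R by rewrite ler1n (leq_ltn_trans _ kn).
      by lra.
    by field; rewrite H1 H2.
  rewrite jacobi_op_sub scalerBr.
  have := djacobip_ode n a b; rewrite -Er.
  move: (jacobi_op a b (djacobip n a b)) (jacobi_op a b r) => t u.
  move: (_ *: djacobip n a b) (_ *: r) => v w E.
  apply/eqP; rewrite -subr_eq0 (_ : _ - _ = (w - u) - (v - t)); last by ring.
  by rewrite E subrr.
- rewrite coefB coef_djacobip coefD coefZ lead_jacobip divfK; last first.
    by rewrite gt_eqF// jacobi_lead_gt0.
  rewrite coef_sum big1 ?add0r ?subrr// => k _.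
  by rewrite coefZ coef_jacobip_gt ?mulr0.
Qed.

End parameter_derivative.

(** * Parameter derivative of the orthonormal polynomials and its coefficients *)

Section orthonormal_derivative.
Variable R : realType.
Implicit Types (x y a b s : R).

(** For n = 0 the logarithmic derivative is that of Γ(1 + s), which stays regular on all of s > -1,
    whereas the generic formula has canceling poles at s = 0. *)
Definition dln_Gamma_mul n s : R :=
  if n is 0 then digam (1 + s) else digam (n%:R + s) + (2 * n%:R + s)^-1.

Definition ddln_Gamma_mul n s : R :=
  if n is 0 then trigam (1 + s) else trigam (n%:R + s) - (2 * n%:R + s) ^- 2.

Lemma is_derive_ln_Gamma_mul n s : -1 < s ->
  is_derive s 1 (fun s => ln (Gamma_mul n s)) (dln_Gamma_mul n s).
Proof.
move=> s1; case: n => [|n].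
  have s0 : 0 < 1 + s by lra.
  apply: is_derive_near s1 _ (is_derive_translate (is_derive_lnGamma s0)).
  by move=> y y1; rewrite Gamma_mulE.
have n1 : 1 <= n.+1%:R :> R by rewrite ler1n.
have H1 : 0 < n.+1%:R + s by lra.
have H2 : 0 < 2 * n.+1%:R + s by lra.
apply: is_derive_near s1 _ (is_derive_add
  (is_derive_translate (is_derive_lnGamma H1))
  (is_derive_translate (is_derive1_ln H2))) => y y1.
have H3 : 0 < n.+1%:R + y by lra.
have H4 : 0 < 2 * n.+1%:R + y by lra.
by rewrite Gamma_mulE// lnM ?posrE ?Gamma_gt0.
Qed.

Lemma is_derive_dln_Gamma_mul n s : -1 < s ->
  is_derive s 1 (dln_Gamma_mul n) (ddln_Gamma_mul n s).
Proof.
move=> s1; case: n => [|n].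
  by apply: is_derive_translate; apply: is_derive_digam; lra.
have n1 : 1 <= n.+1%:R :> R by rewrite ler1n.
have H1 : 0 < n.+1%:R + s by lra.
have H2 : 2 * n.+1%:R + s != 0 by rewrite gt_eqF//; lra.
have := is_derive_add (is_derive_translate (is_derive_digam H1))
  (is_derive_translate (@is_derive_inv _ (fun x => x) _ _ H2 (is_derive_id _ _))).
by rewrite mulN1r.
Qed.

Lemma pochhammer_Gamma x k : 0 < x -> pochhammer x k * Gamma x = Gamma (x + k%:R).
Proof.
move=> x0; elim: k => [|k IH]; first by rewrite pochhammer0 mul1r addr0.
have xk : 0 < x + k%:R by rewrite ltr_wpDr.
have -> : x + k.+1%:R = x + k%:R + 1 by rewrite -natr1 addrA.
by rewrite (GammaS xk) -IH pochhammerSr mulrAC mulrC.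
Qed.

(** A gamma quotient, unlike a Pochhammer product, has a logarithmic derivative in closed form.
    Numerator and denominator are multiplied by 2 n + s so that [Gamma_mul] appears. *)
Lemma jacobi_lead_Gamma n a b : -1 < a + b + 1 ->
  jacobi_lead n a b = Gamma (2 * n%:R + a + b + 2) / (n`!%:R * Gamma_mul n (a + b + 1)).
Proof.
move=> s1; have f0 : n`!%:R != 0 :> R by rewrite pnatr_eq0 -lt0n fact_gt0.
have D0 : Gamma_mul n (a + b + 1) != 0 by rewrite gt_eqF// Gamma_mul_gt0.
apply: (canRL (mulfK (mulf_neq0 f0 D0))); rewrite /jacobi_lead mulrA divfK//.
rewrite Gamma_mulE//; case: n {f0 D0} => [|n].
  by rewrite pochhammer0 mul1r mulr0n mulr0 add0r; congr Gamma; ring.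
have n1 : 1 <= n.+1%:R :> R by rewrite ler1n.
have H1 : 0 < n.+1%:R + (a + b + 1) by lra.
have H2 : 0 < 2 * n.+1%:R + (a + b + 1) by lra.
rewrite mulrA -[_ + a + b + 1]addrA -[_ + a + _]addrA [a + (b + 1)]addrA pochhammer_Gamma//.
have -> : n.+1%:R + (a + b + 1) + n.+1%:R = 2 * n.+1%:R + (a + b + 1) by ring.
by rewrite mulrC -GammaS//; congr Gamma; ring.
Qed.

Lemma djacobi_lead n a b : -1 < a -> -1 < b -> djacobi_coef n a b n =
  jacobi_lead n a b * (digam (2 * n%:R + a + b + 2) - dln_Gamma_mul n (a + b + 1)).
Proof.
move=> a1 b1; apply: is_derive_unique (is_derive_jacobip_coef n a b n) _.
have n0 : 0 <= n%:R :> R by [].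
pose f a' := ln (Gamma (2 * n%:R + a' + b + 2)) - ln (Gamma_mul n (a' + b + 1)).
have H1 : 0 < 2 * n%:R + a + b + 2 by lra.
have s1 : -1 < a + b + 1 by lra.
have df : is_derive a 1 f
    (digam (2 * n%:R + a + b + 2) - dln_Gamma_mul n (a + b + 1)).
  apply: is_derive_sub.
    apply: (@is_derive_shifted _ (fun x => ln (Gamma x))
      (fun a => 2 * n%:R + a + b + 2) (2 * n%:R + b + 2)); first by move=> y; ring.
    exact: is_derive_lnGamma.
  apply: (@is_derive_shifted _ (fun x => ln (Gamma_mul n x))
    (fun a => a + b + 1) (b + 1)); first by move=> y; ring.
  exact: is_derive_ln_Gamma_mul.
have E a' : -1 < a' -> (n`!%:R)^-1 * expR (f a') = jacobi_lead n a' b.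
  move=> a1'; have D0 : 0 < Gamma_mul n (a' + b + 1) by apply: Gamma_mul_gt0; lra.
  rewrite jacobi_lead_Gamma; last by lra.
  have G0 : 0 < Gamma (2 * n%:R + a' + b + 2) by apply: Gamma_gt0; lra.
  by rewrite /f expRB !lnK ?posrE// mulrC invfM mulrA mulrAC.
rewrite -E// -mulrA.
apply: is_derive_near a1 _ (is_derive_scale _ (is_derive_expR_comp df)).
by move=> a' a1'; rewrite E// lead_jacobip.
Qed.

Definition dln_jacobi_sqnorm n a b : R :=
  ln 2 + digam (n%:R + a + 1) - dln_Gamma_mul n (a + b + 1).

Lemma is_derive_jacobi_norm n a b : -1 < a -> -1 < b ->
  is_derive a 1 (fun a => jacobi_norm n a b)
    (jacobi_norm n a b * (2^-1 * dln_jacobi_sqnorm n a b)).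
Proof.
move=> a1 b1; have n0 : 0 <= n%:R :> R by [].
pose f a' := (a' + b + 1) * ln 2 + ln (Gamma (n%:R + a' + 1)) -
  ln (Gamma_mul n (a' + b + 1)).
pose c := ln (Gamma (n%:R + b + 1)) - ln (n`!%:R).
have s1 : -1 < a + b + 1 by lra.
have H1 : 0 < n%:R + a + 1 by lra.
have df : is_derive a 1 f (dln_jacobi_sqnorm n a b).
  apply: is_derive_sub.
    apply: is_derive_add.
      apply: (@is_derive_shifted _ (fun x => x * ln 2)
        (fun a => a + b + 1) (b + 1)); first by move=> y; ring.
      have := is_derive_mul (is_derive_id (a + b + 1) 1)
        (is_derive_cst (ln 2 : R) (a + b + 1) 1).
      by rewrite mul1r mulr0 addr0.
    apply: (@is_derive_shifted _ (fun x => ln (Gamma x))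
      (fun a => n%:R + a + 1) (n%:R + 1)); first by move=> y; ring.
    exact: is_derive_lnGamma.
  apply: (@is_derive_shifted _ (fun x => ln (Gamma_mul n x))
    (fun a => a + b + 1) (b + 1)); first by move=> y; ring.
  exact: is_derive_ln_Gamma_mul.
have df2 : is_derive a 1 (fun a => 2^-1 * (f a + c)) (2^-1 * dln_jacobi_sqnorm n a b).
  apply: is_derive_scale; rewrite -[dln_jacobi_sqnorm n a b]addr0.
  exact: is_derive_add df (is_derive_cst c a 1).
have E a' : -1 < a' -> expR (2^-1 * (f a' + c)) = jacobi_norm n a' b.
  move=> a1'.
  have h0 := jacobi_sqnorm_gt0 n a1' b1.
  rewrite -[jacobi_norm _ _ _]/(Num.sqrt (jacobi_sqnorm n a' b)).
  rewrite -powR12_sqrt ?(ltW h0)// powR_expR//; congr (expR (_ * _)).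
  have G1 : 0 < Gamma (n%:R + a' + 1) by apply: Gamma_gt0; lra.
  have G2 : 0 < Gamma (n%:R + b + 1) by apply: Gamma_gt0; lra.
  have G3 : 0 < Gamma_mul n (a' + b + 1) by apply: Gamma_mul_gt0; lra.
  have f0 : 0 < n`!%:R :> R by rewrite ltr0n fact_gt0.
  rewrite /jacobi_sqnorm ln_div ?posrE ?mulr_gt0 ?powR_gt0//.
  rewrite !lnM ?posrE ?mulr_gt0 ?powR_gt0// ln_powR /f /c.
  by ring.
rewrite -E//.
by apply: is_derive_near a1 _ (is_derive_expR_comp df2).
Qed.

(** The logarithmic derivative in a of the leading coefficient of the orthonormal polynomial: that
    of [jacobi_lead] minus half that of the squared norm. *)
Definition acoef_top n a b : R :=
  digam (2 * n%:R + a + b + 2) -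
  2^-1 * (ln 2 + digam (n%:R + a + 1) + dln_Gamma_mul n (a + b + 1)).

Definition acoef n k a b : R :=
  if (k < n)%N then froehlich_coef n k a b * (jacobi_norm k a b / jacobi_norm n a b)
  else acoef_top n a b.

Definition dojacobip n a b : {poly R} :=
  \sum_(k < n.+1) acoef n k a b *: ojacobip k a b.

Lemma size_ojacobip n a b : (size (ojacobip n a b) <= n.+1)%N.
Proof. exact: leq_trans (size_scale_leq _ _) (size_jacobip _ _ _). Qed.

Lemma size_dojacobip n a b : (size (dojacobip n a b) <= n.+1)%N.
Proof.
apply: (leq_trans (size_sum _ _ _)); apply/bigmax_leqP => k _.
exact: leq_trans (size_scale_leq _ _) (leq_trans (size_ojacobip _ _ _) (ltn_ord k)).
Qed.

Lemma dojacobipE n a b : -1 < a -> -1 < b -> dojacobip n a b =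
  (jacobi_norm n a b)^-1 *: djacobip n a b -
  (2^-1 * dln_jacobi_sqnorm n a b) *: ojacobip n a b.
Proof.
move=> a1 b1; have d0 k : jacobi_norm k a b != 0 by rewrite gt_eqF// jacobi_norm_gt0.
rewrite /dojacobip big_ord_recr/= djacobip_expansion// scalerDr -addrA; congr (_ + _).
  rewrite scaler_sumr; apply: eq_bigr => k _.
  rewrite /acoef ltn_ord /ojacobip !scalerA; congr (_ *: _).
  by field; rewrite !d0.
rewrite /acoef ltnn djacobi_lead// /ojacobip !scalerA -scalerBl; congr (_ *: _).
have k0 : jacobi_lead n a b != 0 by rewrite gt_eqF// jacobi_lead_gt0//; lra.
rewrite [jacobi_lead n a b * _]mulrC mulfK// /acoef_top /dln_jacobi_sqnorm.
by field; rewrite d0.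
Qed.

Lemma is_derive_ojacobip_coef n a b l : -1 < a -> -1 < b ->
  is_derive a 1 (fun a => (ojacobip n a b)`_l) (dojacobip n a b)`_l.
Proof.
move=> a1 b1; have d0 : jacobi_norm n a b != 0 by rewrite gt_eqF// jacobi_norm_gt0.
have -> : (fun a => (ojacobip n a b)`_l) =
    (fun a => (jacobi_norm n a b)^-1 * (jacobip n a b)`_l).
  by apply/funext => y; rewrite coefZ.
have := is_derive_mul (@is_derive_inv _ (fun a => jacobi_norm n a b) _ _ d0
    (is_derive_jacobi_norm n a1 b1))
  (is_derive_jacobip_coef n a b l).
move=> H; apply: is_derive_eq H _.
rewrite dojacobipE// coefB !coefZ coef_djacobip.
by field.
Qed.

Lemma is_derive_ojacobi n a b x : -1 < a -> -1 < b ->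
  is_derive a 1 (fun a => ojacobi n a b x) (dojacobip n a b).[(x - 1) / 2].
Proof.
move=> a1 b1.
have -> : (fun a => ojacobi n a b x) = (fun a => (ojacobip n a b).[(x - 1) / 2]).
  by apply/funext => y; rewrite ojacobiE.
apply: (@is_derive_horner_path _ _ _ _ _ n.+1).
- by move=> a'; exact: size_ojacobip.
- exact: size_dojacobip.
- by move=> l; exact: is_derive_ojacobip_coef.
Qed.

(* Orthonormality makes the coefficients of an expansion unique, so that the
   [xget] of [ojacobi_coef] has a single value to choose from. *)
Lemma ojacobi_coefE n a b (c : nat -> R) (f : R -> R) k : -1 < a -> -1 < b ->
  (forall x, f x = \sum_(j < n.+1) c j * ojacobi j a b x) -> (k <= n)%N ->
  ojacobi_coef n a b f k = c k.
Proof.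
move=> a1 b1 fE kn; rewrite /ojacobi_coef.
set S := (X in xget _ X).
have SE (A : 'rV[R]_n.+1) : S A -> A 0 (inord k) = c k.
  have val (d : nat -> R) : (forall x, f x = \sum_(j < n.+1) d j * ojacobi j a b x) ->
      d k = \int[@lebesgue_measure R]_(x in `](-1), 1[)
        (ln (1 - x) ^+ 0 * (jacobi_weight a b x * (f x * ojacobi k a b x))).
    move=> fd; transitivity
      (jacobi_integral 0 a b (\sum_(j < n.+1) d j *: (ojacobip j a b * ojacobip k a b))).
      rewrite (@jacobi_integral_sum _ _ _ a1 b1 _ _ d (fun j => ojacobip j a b * ojacobip k a b)).
      rewrite (bigD1 (Ordinal (kn : (k < n.+1)%N)))//= ojacobip_orthonormal// eqxx mulr1.
      rewrite big1 ?addr0// => j; rewrite -val_eqE/= => /negbTE jk.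
      by rewrite ojacobip_orthonormal// jk mulr0.
    rewrite jacobi_integralE; apply: eq_Rintegral => x _; congr (_ * (_ * _)).
    rewrite fd horner_sum mulr_suml; apply: eq_bigr => j _.
    by rewrite hornerZ hornerM !ojacobiE mulrA.
  move=> SA; rewrite (val c fE) -(val (fun j => A 0 (inord j)))// => x.
  by rewrite (SA x); apply: eq_bigr => j _; rewrite inord_val.
apply: SE; apply: (@xgetPex _ 0 S); exists (\row_j c j) => x.
by rewrite fE; apply: eq_bigr => j _; rewrite mxE.
Qed.

Lemma coefA_alphaE n k a b : -1 < a -> -1 < b -> (k <= n)%N ->
  coefA_alpha n k a b = acoef n k a b.
Proof.
move=> a1 b1 kn; apply: (@ojacobi_coefE n a b (fun k => acoef n k a b)) => // x.
rewrite (is_derive_derive1 (is_derive_ojacobi n x a1 b1)) horner_sum.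
by apply: eq_bigr => j _; rewrite hornerZ ojacobiE.
Qed.

Definition dacoef_top n a b : R :=
  trigam (2 * n%:R + a + b + 2) -
  2^-1 * (trigam (n%:R + a + 1) + ddln_Gamma_mul n (a + b + 1)).

Lemma is_derive_acoef_top n a b : -1 < a -> -1 < b ->
  is_derive a 1 (fun a => acoef_top n a b) (dacoef_top n a b).
Proof.
move=> a1 b1; have n0 : 0 <= n%:R :> R by [].
apply: is_derive_sub.
  apply: (@is_derive_shifted _ (@digam R)
    (fun a => 2 * n%:R + a + b + 2) (2 * n%:R + b + 2)); first by move=> y; ring.
  by apply: is_derive_digam; lra.
apply: is_derive_scale; apply: is_derive_add.
  rewrite -[trigam _]add0r; apply: is_derive_add.
  apply: (@is_derive_shifted _ (@digam R)
    (fun a => n%:R + a + 1) (n%:R + 1)); first by move=> y; ring.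
  by apply: is_derive_digam; lra.
apply: (@is_derive_shifted _ (@dln_Gamma_mul n)
  (fun a => a + b + 1) (b + 1)); first by move=> y; ring.
by apply: is_derive_dln_Gamma_mul; lra.
Qed.

Lemma derive1_coefA_alpha n a b : -1 < a -> -1 < b ->
  derive1 (fun a => coefA_alpha n n a b) a = dacoef_top n a b.
Proof.
move=> a1 b1; apply: is_derive_derive1.
apply: is_derive_near a1 _ (is_derive_acoef_top n a1 b1) => y y1.
by rewrite coefA_alphaE// /acoef ltnn.
Qed.

(** The argument 2 n + s + 1 is lowered to 2 n + s by the trigamma recurrence. This yields 2 / (2 n
    + s)^2, of which the factor 2 n + s in the norm takes back one half. *)
Lemma dacoef_topE n a b : -1 < a -> -1 < b -> - 2 * dacoef_top n a b =
  trigamma_part n (a + b + 1) + trigamma (n%:R + a + 1).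
Proof.
move=> a1 b1; have n0 : 0 <= n%:R :> R by [].
rewrite trigamma_partE; last by lra.
rewrite trigamma_pos; last by lra.
rewrite /dacoef_top /ddln_Gamma_mul; case: n n0 => [|n] n0.
  by rewrite mulr0n mulr0 !add0r (_ : a + b + 2 = 1 + (a + b + 1)); [field|ring].
have n1 : 1 <= n.+1%:R :> R by rewrite ler1n.
have H1 : 0 < 2 * n.+1%:R + (a + b + 1) by lra.
have -> : 2 * n.+1%:R + a + b + 2 = 2 * n.+1%:R + (a + b + 1) + 1 by ring.
rewrite (trigamS H1); move: (trigam _) (trigam _) (trigam _) => u v w.
move: (2 * n.+1%:R + _) H1 => t t0.
by field; rewrite gt_eqF.
Qed.

End orthonormal_derivative.

(** * Fisher information *)

Section fisher.
Variable R : realType.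
Implicit Types (x y a b s : R).

Local Notation J := (@jacobi_integral R).

Lemma is_derive_coefM (p q : R -> {poly R}) (dp dq : {poly R}) a :
  (forall l, is_derive a 1 (fun a' => (p a')`_l) dp`_l) ->
  (forall l, is_derive a 1 (fun a' => (q a')`_l) dq`_l) ->
  forall l, is_derive a 1 (fun a' => (p a' * q a')`_l) (dp * q a + p a * dq)`_l.
Proof.
move=> Hp Hq l.
have -> : (fun a' => (p a' * q a')`_l) =
    (fun a' => \sum_(i < l.+1) (p a')`_i * (q a')`_(l - i)).
  by apply/funext => y; rewrite coefM.
have H := @is_derive_bigsum _ l.+1 (fun i a' => (p a')`_i * (q a')`_(l - i)) a _
  (fun i _ => is_derive_mul (Hp i) (Hq (l - i)%N)).
apply: is_derive_eq H _.
by rewrite coefD !coefM -big_split.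
Qed.

Lemma is_derive_jacobi_integral_ojacobip j n k a b : -1 < a -> -1 < b ->
  is_derive a 1 (fun a => J j a b (ojacobip n a b * ojacobip k a b))
    (J j.+1 a b (ojacobip n a b * ojacobip k a b) +
     J j a b (dojacobip n a b * ojacobip k a b + ojacobip n a b * dojacobip k a b)).
Proof.
move=> a1 b1.
apply: (@is_derive_jacobi_integral_path _ _ _ _ _ _ (n.+1 + k.+1)) => //.
- move=> a'; rewrite (leq_trans (size_polyMleq _ _))// (leq_trans (leq_pred _))//.
  by rewrite leq_add ?size_ojacobip.
- rewrite (leq_trans (size_polyD _ _))// geq_max; apply/andP; split.
    rewrite (leq_trans (size_polyMleq _ _))// (leq_trans (leq_pred _))//.
    by rewrite leq_add ?size_ojacobip ?size_dojacobip.
  rewrite (leq_trans (size_polyMleq _ _))// (leq_trans (leq_pred _))//.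
  by rewrite leq_add ?size_ojacobip ?size_dojacobip.
- by apply: is_derive_coefM => l; exact: is_derive_ojacobip_coef.
Qed.

Section fixed_parameters.
Variables a b : R.
Hypotheses (a1 : -1 < a) (b1 : -1 < b).

Lemma jacobi_integral_dojacobip m k :
  J 0 a b (dojacobip m a b * ojacobip k a b) = if (k <= m)%N then acoef m k a b else 0.
Proof.
rewrite /dojacobip mulr_suml.
have -> : \sum_(i < m.+1) acoef m i a b *: ojacobip i a b * ojacobip k a b =
    \sum_(i < m.+1) acoef m i a b *: (ojacobip i a b * ojacobip k a b).
  by apply: eq_bigr => i _; rewrite scalerAl.
rewrite (@jacobi_integral_sum _ _ _ a1 b1 _ _ (fun i => acoef m i a b)
  (fun i => ojacobip i a b * ojacobip k a b)).
case: leqP => km.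
  rewrite (bigD1 (Ordinal (km : (k < m.+1)%N)))//= ojacobip_orthonormal// eqxx mulr1.
  rewrite big1 ?addr0// => i; rewrite -val_eqE/= => /negbTE ik.
  by rewrite ojacobip_orthonormal// ik mulr0.
rewrite big1// => i _; rewrite ojacobip_orthonormal// ltn_eqF ?mulr0//.
exact: leq_trans (ltn_ord i) km.
Qed.

(** The derivative of the constant inner product vanishes. For k < m the product of [ojacobip m]
    with [dojacobip k], of degree at most k, integrates to zero; for k = m the two products
    coincide, which doubles the coefficient. *)
Lemma jacobi_integral_ln_ojacobip m k : (k <= m)%N ->
  J 1 a b (ojacobip m a b * ojacobip k a b) =
  - (acoef m k a b + if k == m then acoef m k a b else 0).
Proof.
move=> km; have H := is_derive_jacobi_integral_ojacobip 0 m k a1 b1.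
have H0 : is_derive a 1 (fun a => J 0 a b (ojacobip m a b * ojacobip k a b)) 0.
  apply: is_derive_near a1 _ (is_derive_cst ((m == k)%:R : R) a 1) => y y1.
  by rewrite ojacobip_orthonormal.
have /eqP := is_derive_unique H H0; rewrite addr_eq0 => /eqP ->.
rewrite jacobi_integralD// [ojacobip m a b * _]mulrC !jacobi_integral_dojacobip km.
by case: ltngtP km => // ->.
Qed.

End fixed_parameters.

Lemma jacobi_integral_ln_square n a b : -1 < a -> -1 < b ->
  J 1 a b (ojacobip n a b * ojacobip n a b) = - 2 * acoef_top n a b.
Proof.
move=> a1 b1; rewrite jacobi_integral_ln_ojacobip// eqxx /acoef ltnn.
by ring.
Qed.

Lemma jacobi_integral_ln2_square n a b : -1 < a -> -1 < b ->
  J 2 a b (ojacobip n a b * ojacobip n a b) +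
    2 * J 1 a b (ojacobip n a b * dojacobip n a b) = - 2 * dacoef_top n a b.
Proof.
move=> a1 b1; have H := is_derive_jacobi_integral_ojacobip 1 n n a1 b1.
have H1 : is_derive a 1 (fun a => J 1 a b (ojacobip n a b * ojacobip n a b))
    (- 2 * dacoef_top n a b).
  apply: is_derive_near a1 _ (is_derive_scale (- 2) (is_derive_acoef_top n a1 b1)).
  by move=> y y1; rewrite jacobi_integral_ln_square.
rewrite -(is_derive_unique H H1) jacobi_integralD// [dojacobip n a b * _]mulrC.
by rewrite mulr_natl mulr2n.
Qed.

Lemma jacobi_integral_ln_dojacobip n a b : -1 < a -> -1 < b ->
  J 1 a b (ojacobip n a b * dojacobip n a b) =
  - \sum_(k < n) acoef n k a b ^+ 2 - 2 * acoef_top n a b ^+ 2.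
Proof.
move=> a1 b1; rewrite /dojacobip mulr_sumr.
have -> : \sum_(k < n.+1) ojacobip n a b * (acoef n k a b *: ojacobip k a b) =
    \sum_(k < n.+1) acoef n k a b *: (ojacobip n a b * ojacobip k a b).
  by apply: eq_bigr => k _; rewrite scalerAr.
rewrite (@jacobi_integral_sum _ _ _ a1 b1 _ _ (fun k => acoef n k a b)
  (fun k => ojacobip n a b * ojacobip k a b)).
rewrite big_ord_recr/= jacobi_integral_ln_square//; congr (_ + _).
  rewrite -sumrN; apply: eq_bigr => k _.
  by rewrite jacobi_integral_ln_ojacobip// ?(ltnW (ltn_ord k))// ltn_eqF// addr0 mulrN.
by rewrite /acoef ltnn; ring.
Qed.

Lemma jacobi_integral_dojacobip_square n a b : -1 < a -> -1 < b ->
  J 0 a b (dojacobip n a b * dojacobip n a b) =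
  \sum_(k < n) acoef n k a b ^+ 2 + acoef_top n a b ^+ 2.
Proof.
move=> a1 b1; rewrite {2}/dojacobip mulr_sumr.
have -> : \sum_(k < n.+1) dojacobip n a b * (acoef n k a b *: ojacobip k a b) =
    \sum_(k < n.+1) acoef n k a b *: (dojacobip n a b * ojacobip k a b).
  by apply: eq_bigr => k _; rewrite scalerAr.
rewrite (@jacobi_integral_sum _ _ _ a1 b1 _ _ (fun k => acoef n k a b)
  (fun k => dojacobip n a b * ojacobip k a b)).
rewrite big_ord_recr/= jacobi_integral_dojacobip// leqnn; congr (_ + _).
  by apply: eq_bigr => k _; rewrite jacobi_integral_dojacobip// (ltnW (ltn_ord k)).
by rewrite /acoef ltnn.
Qed.

Lemma is_derive_sqrt_jacobi_weight a b x : 0 < 1 + x -> 0 < 1 - x ->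
  is_derive a 1 (fun a => Num.sqrt (jacobi_weight a b x))
    (Num.sqrt (jacobi_weight a b x) * (2^-1 * ln (1 - x))).
Proof.
move=> x1 x2.
have E c : Num.sqrt (jacobi_weight c b x) =
    expR (2^-1 * ln (1 - x) * c + 2^-1 * (b * ln (1 + x))).
  rewrite -powR12_sqrt ?mulr_ge0 ?powR_ge0// powR_expR ?mulr_gt0 ?powR_gt0//.
  by rewrite /jacobi_weight lnM ?posrE ?powR_gt0// !ln_powR; congr expR; ring.
rewrite E (funext E); apply: is_derive_expR_comp.
have := is_derive_add (is_derive_scale (2^-1 * ln (1 - x)) (is_derive_id a 1))
  (is_derive_cst (2^-1 * (b * ln (1 + x)) : R) a 1).
by rewrite mulr1 addr0.
Qed.

Definition jacobi_expfam j a b q : R -> R :=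
  expfam (fun x => (1 + x) `^ b * q.[(x - 1) / 2]) (fun x => ln (1 - x)) j a.

(** The squared derivative, sorted by powers of ln (1 - x), so that each term belongs to the
    exponential family and is known to be integrable. *)
Definition fisher_density n a b x : R :=
  jacobi_expfam 2 a b (4^-1 *: (ojacobip n a b * ojacobip n a b)) x +
  (jacobi_expfam 1 a b (ojacobip n a b * dojacobip n a b) x +
   jacobi_expfam 0 a b (dojacobip n a b * dojacobip n a b) x).

(** Differentiability is kept together with the value of the square: the second parameter reuses
    both at the point - x. *)
Lemma fisher_densityE n a b x : -1 < a -> -1 < b -> `](-1), 1[%classic x ->
  exists2 d, is_derive a 1 (fun a' : R =>
    Num.sqrt (jacobi_weight a' b x) * ojacobi n a' b x) d &
  d ^+ 2 = fisher_density n a b x.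
Proof.
move=> a1 b1 xI; have /itv11P[x1 x2] := xI.
exists (Num.sqrt (jacobi_weight a b x) * (2^-1 * ln (1 - x)) * ojacobi n a b x +
  Num.sqrt (jacobi_weight a b x) * (dojacobip n a b).[(x - 1) / 2]).
  exact: is_derive_mul (is_derive_sqrt_jacobi_weight a b x1 x2)
    (is_derive_ojacobi n x a1 b1).
rewrite /fisher_density /jacobi_expfam !expfam_jacobi// ojacobiE.
have w0 : 0 <= jacobi_weight a b x by rewrite mulr_ge0 ?powR_ge0.
rewrite (hornerZ 4^-1) !hornerM -[in RHS](sqr_sqrtr w0).
by move: (Num.sqrt _) ((ojacobip n a b).[_]) ((dojacobip n a b).[_]) => w p d; field.
Qed.

Lemma integrable_jacobi_expfam j a b q : -1 < a -> -1 < b ->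
  (@lebesgue_measure R).-integrable `](-1), 1[%classic (EFin \o jacobi_expfam j a b q).
Proof. exact: integrable_expfam_jacobi. Qed.

Let integrable_density_low n a b : -1 < a -> -1 < b ->
  (@lebesgue_measure R).-integrable `](-1), 1[%classic (EFin \o (fun x =>
   jacobi_expfam 1 a b (ojacobip n a b * dojacobip n a b) x +
   jacobi_expfam 0 a b (dojacobip n a b * dojacobip n a b) x)).
Proof.
move=> a1 b1.
have := @integrableD _ _ _ (@lebesgue_measure R) _ (measurable_itv _) _ _
  (integrable_jacobi_expfam 1 (ojacobip n a b * dojacobip n a b) a1 b1)
  (integrable_jacobi_expfam 0 (dojacobip n a b * dojacobip n a b) a1 b1).
exact.
Qed.

Lemma integrable_fisher_density n a b : -1 < a -> -1 < b ->
  (@lebesgue_measure R).-integrable `](-1), 1[%classic (EFin \o fisher_density n a b).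
Proof.
move=> a1 b1.
have := @integrableD _ _ _ (@lebesgue_measure R) _ (measurable_itv _) _ _
  (integrable_jacobi_expfam 2 (4^-1 *: (ojacobip n a b * ojacobip n a b)) a1 b1)
  (integrable_density_low n a1 b1).
exact.
Qed.

Lemma integral_fisher_density n a b : -1 < a -> -1 < b ->
  (\int[@lebesgue_measure R]_(x in `](-1)%R, 1%R[) (fisher_density n a b x)%:E =
  (4^-1 * J 2 a b (ojacobip n a b * ojacobip n a b) +
   (J 1 a b (ojacobip n a b * dojacobip n a b) +
    J 0 a b (dojacobip n a b * dojacobip n a b)))%:E)%E.
Proof.
move=> a1 b1.
have E : \int[@lebesgue_measure R]_(x in `](-1), 1[) fisher_density n a b x =
    4^-1 * J 2 a b (ojacobip n a b * ojacobip n a b) +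
    (J 1 a b (ojacobip n a b * dojacobip n a b) +
     J 0 a b (dojacobip n a b * dojacobip n a b)).
  rewrite -jacobi_integralZ// /fisher_density RintegralD//; last 2 first.
  - exact: integrable_jacobi_expfam.
  - exact: integrable_density_low.
  by rewrite RintegralD//; exact: integrable_jacobi_expfam.
rewrite -E; apply: esym; apply: fineK.
exact: integrable_fin_num (integrable_fisher_density n a1 b1).
Qed.

Lemma fisher_alpha_density n a b : -1 < a -> -1 < b -> fisher_alpha n a b =
  (4%:E * \int[@lebesgue_measure R]_(x in `](-1)%R, 1%R[) (fisher_density n a b x)%:E)%E.
Proof.
move=> a1 b1; congr (_ * _)%E; apply: eq_integral => x /set_mem xI; congr EFin.
by have [d /is_derive_derive1 -> ->] := fisher_densityE n a1 b1 xI.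
Qed.

Lemma fisher_alphaE n a b : -1 < a -> -1 < b -> fisher_alpha n a b =
  (J 2 a b (ojacobip n a b * ojacobip n a b) +
   4 * J 1 a b (ojacobip n a b * dojacobip n a b) +
   4 * J 0 a b (dojacobip n a b * dojacobip n a b))%:E.
Proof.
move=> a1 b1; rewrite fisher_alpha_density// integral_fisher_density// -EFinM.
by congr EFin; field.
Qed.

(** Eliminating [J 2] leaves - 2 DA_n + 2 J_1 + 4 J_0, where J_1 and J_0 are the integrals of L P_n
    D P_n and (D P_n)^2 against the weight. The squares of A_n cancel, and two of the four copies of
    the remaining sum survive. *)
Lemma fisher_alpha_coef n a b : -1 < a -> -1 < b -> fisher_alpha n a b =
  (2 * (\sum_(k < n) acoef n k a b ^+ 2) - 2 * dacoef_top n a b)%:E.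
Proof.
move=> a1 b1; rewrite fisher_alphaE//; congr EFin.
have := jacobi_integral_ln2_square n a1 b1.
rewrite jacobi_integral_ln_dojacobip// jacobi_integral_dojacobip_square//.
move: (J _ _ _ _) (\sum_(k < n) _) (acoef_top n a b) (dacoef_top n a b) => u v w t H.
have -> : u = - 2 * t - 2 * (- v - 2 * w ^+ 2) by rewrite -H; ring.
by ring.
Qed.

Lemma acoef_sqr n k a b : -1 < a -> -1 < b -> (k < n)%N -> acoef n k a b ^+ 2 =
  Gamma (n%:R + b + 1) * n`!%:R * (2 * n%:R + (a + b + 1))
  / (Gamma (n%:R + a + 1) * Gamma (n%:R + (a + b + 1))) *
  (Gamma (k%:R + a + 1) * Gamma_mul k (a + b + 1)
   / (Gamma (k%:R + b + 1) * k`!%:R * (n%:R - k%:R) ^+ 2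
      * (n%:R + k%:R + (a + b + 1)) ^+ 2)).
Proof.
move=> a1 b1 kn; rewrite /acoef kn exprMn (expr_div_n (jacobi_norm k a b)) !jacobi_norm_sqr//.
have n1 : 1 <= n%:R :> R by rewrite ler1n (leq_ltn_trans _ kn).
have k0 : 0 <= k%:R :> R by [].
have s1 : -1 < a + b + 1 by lra.
(* As k < n, n is at least 1 and [Gamma_mul] is an ordinary product; only the factor with index k
   may still be a limit. *)
have DnE : Gamma_mul n (a + b + 1) =
    Gamma (n%:R + (a + b + 1)) * (2 * n%:R + (a + b + 1)).
  by rewrite Gamma_mulE//; case: n kn {n1}.
rewrite /froehlich_coef /lowering_coef /jacobi_sqnorm DnE.
have nE c : n%:R + a + b + c = n%:R + (a + b + c) by ring.
rewrite !nE (_ : n%:R + k%:R + a + b + 1 = n%:R + k%:R + (a + b + 1)); last by ring.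
have H1 : Gamma (n%:R + b + 1) != 0 by rewrite gt_eqF// Gamma_gt0//; lra.
have H2 : Gamma (n%:R + a + 1) != 0 by rewrite gt_eqF// Gamma_gt0//; lra.
have H3 : Gamma (n%:R + (a + b + 1)) != 0 by rewrite gt_eqF// Gamma_gt0//; lra.
have H4 : Gamma (k%:R + b + 1) != 0 by rewrite gt_eqF// Gamma_gt0//; lra.
have H5 : Gamma (k%:R + a + 1) != 0 by rewrite gt_eqF// Gamma_gt0//; lra.
have H6 : Gamma_mul k (a + b + 1) != 0 by rewrite gt_eqF// Gamma_mul_gt0//; lra.
have H7 : n`!%:R != 0 :> R by rewrite pnatr_eq0 -lt0n fact_gt0.
have H8 : k`!%:R != 0 :> R by rewrite pnatr_eq0 -lt0n fact_gt0.
have H9 : n%:R - k%:R != 0 :> R by rewrite subr_eq0 eqr_nat gtn_eqF.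
have H10 : n%:R + k%:R + (a + b + 1) != 0 by rewrite gt_eqF//; lra.
have H11 : 2 * n%:R + (a + b + 1) != 0 by rewrite gt_eqF//; lra.
have H12 : 2 `^ (a + b + 1) != 0 :> R by rewrite gt_eqF// powR_gt0.
move: (2 `^ _) H12 (Gamma (n%:R + b + 1)) H1 => p H12 g1 H1.
move: (Gamma (n%:R + a + 1)) H2 => g2 H2.
move: (Gamma (n%:R + _)) H3 (Gamma (k%:R + b + 1)) H4 => g3 H3 g4 H4.
move: (Gamma (k%:R + a + 1)) H5 => g5 H5.
move: (Gamma_mul _ _) H6 (n`!%:R) H7 (k`!%:R) H8 => g6 H6 f1 H7 f2 H8.
move: (n%:R - k%:R) H9 (n%:R + k%:R + _) H10 (2 * n%:R + _) H11 => u H9 v H10 w H11.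
by field; rewrite H1 H2 H3 H4 H6 H7 H8 H9 H10 H11 H12.
Qed.

Lemma fisher_alpha_correct n a b : -1 < a -> -1 < b ->
  let s := a + b + 1 in
  fisher_alpha n a b =
    (2 * (\sum_(k < n) coefA_alpha n k a b ^+ 2)
     - 2 * derive1 (fun a' : R => coefA_alpha n n a' b) a)%:E /\
  fisher_alpha n a b =
    (2 * (Gamma (n%:R + b + 1) * n`!%:R * (2 * n%:R + s)
          / (Gamma (n%:R + a + 1) * Gamma (n%:R + s)))
       * (\sum_(k < n)
            Gamma (k%:R + a + 1) * Gamma_mul k s
            / (Gamma (k%:R + b + 1) * k`!%:R * (n%:R - k%:R) ^+ 2
               * (n%:R + k%:R + s) ^+ 2))
     + (trigamma_part n s + trigamma (n%:R + a + 1)))%:E.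
Proof.
move=> a1 b1 s; rewrite fisher_alpha_coef//; split; congr EFin.
  rewrite derive1_coefA_alpha//; congr (2 * _ - _); apply: eq_bigr => k _.
  by rewrite coefA_alphaE// ltnW.
rewrite -dacoef_topE// -[in RHS]mulrA mulNr; congr (2 * _ - _).
(* Every term has k < n. For n = 0 both sums are empty, including the case s = 0 where the prefactor
   is at the pole of Γ. *)
by rewrite mulr_sumr; apply: eq_bigr => k _; rewrite acoef_sqr.
Qed.

End fisher.

(** * Exchanging the two parameters *)

Section reflection.
Variable R : realType.
Implicit Types (x y a b s : R) (p : {poly R}).

(** In the variable y = (x - 1) / 2 the reflection x -> - x reads y -> - 1 - y. *)
Lemma jacobi_op_reflect a b p :
  jacobi_op a b (p \Po (- 1 - 'X)) = jacobi_op b a p \Po (- 1 - 'X).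
Proof.
have dv : (- 1 - 'X : {poly R})^`() = -1.
  by rewrite derivB derivN derivX -[1 in LHS]/(1%:P) derivC oppr0 sub0r.
rewrite /jacobi_op !(comp_polyD, comp_polyM, comp_polyZ, comp_polyX, comp_polyC).
rewrite !deriv_comp !dv derivM deriv_comp dv derivN -[1 in X in _ * X + _]/(1%:P).
rewrite derivC oppr0 mulr0 addr0.
move: (p^`()^`() \Po _) (p^`() \Po _) => u v.
rewrite -!mul_polyC !polyCD -[1%:P]/(1 : {poly R}).
by ring.
Qed.

Lemma jacobi_leadC n a b : jacobi_lead n b a = jacobi_lead n a b.
Proof. by rewrite /jacobi_lead [_ + b + a]addrAC. Qed.

(** Both sides are eigenvectors for the same eigenvalue, and the sign (-1)^n matches their leading
    coefficients. *)
Lemma jacobip_reflect n a b : -1 < a + b + 1 ->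
  jacobip n a b = (-1) ^+ n *: (jacobip n b a \Po (- 1 - 'X)).
Proof.
move=> s1; have s1' : -1 < b + a + 1 by lra.
have l0 : jacobi_lead n b a != 0 by rewrite gt_eqF// jacobi_lead_gt0.
have sp : size (jacobip n b a) = n.+1.
  apply/eqP; rewrite eqn_leq size_jacobip/= ltnNge; apply/negP => sn.
  by have := lead_jacobip n b a; rewrite nth_default// => /esym/eqP; rewrite (negbTE l0).
have vE : - 1 - 'X = - ('X - (-1)%:P) :> {poly R} by rewrite polyCN opprK opprD addrC.
have sv : size (- 1 - 'X : {poly R}) = 2%N by rewrite vE size_polyN size_XsubC.
have lv : lead_coef (- 1 - 'X : {poly R}) = -1 by rewrite vE lead_coefN lead_coefXsubC.
have sc : size (jacobip n b a \Po (- 1 - 'X)) = n.+1 by rewrite size_comp_poly2.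
have lc : (jacobip n b a \Po (- 1 - 'X))`_n = (-1) ^+ n * jacobi_lead n b a.
  have := lead_coef_comp (jacobip n b a) (_ : (1 < size ((- 1 - 'X)%R : {poly R}))%N).
  rewrite sv => /(_ isT); rewrite lv !lead_coefE sp sc/= lead_jacobip => ->.
  by rewrite mulrC.
apply/eqP; rewrite -subr_eq0; apply/eqP; apply: (@jacobi_op_eigen0 _ n a b) => //.
- rewrite (leq_trans (size_polyD _ _))// size_polyN geq_max size_jacobip/=.
  by rewrite (leq_trans (size_scale_leq _ _))// sc.
- rewrite jacobi_op_sub jacobi_opZ jacobi_op_reflect !jacobi_op_eigen comp_polyZ scalerBr.
  congr (_ - _); rewrite !scalerA [n%:R + b + a]addrAC; congr (_ *: _); exact: mulrC.
- rewrite coefB coefZ lc mulrA -exprMn mulrNN mulr1 expr1n mul1r lead_jacobip.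
  by rewrite jacobi_leadC subrr.
Qed.

Lemma jacobi_normC n a b : jacobi_norm n b a = jacobi_norm n a b.
Proof.
rewrite /jacobi_norm [b + a]addrC; congr (Num.sqrt (_ / _)); exact: mulrAC.
Qed.

Lemma ojacobi_reflect n a b x : -1 < a + b + 1 ->
  ojacobi n a b x = (-1) ^+ n * ojacobi n b a (- x).
Proof.
move=> s1; rewrite /ojacobi !jacobiE jacobip_reflect// hornerZ horner_comp.
rewrite jacobi_normC mulrA; congr (_ * _.[_] / _).
by rewrite !hornerE; field.
Qed.

Lemma jacobi_weight_reflect a b x : jacobi_weight a b x = jacobi_weight b a (- x).
Proof. by rewrite /jacobi_weight opprK mulrC. Qed.

(** Reflecting [ojacobi n] contributes (-1)^n, and reflecting back each [ojacobi k] contributes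
    (-1)^k. The sign disappears in the squares and for k = n. *)
Lemma coefA_betaE n k a b : -1 < a -> -1 < b -> (k <= n)%N ->
  coefA_beta n k a b = (-1) ^+ (n + k) * coefA_alpha n k b a.
Proof.
move=> a1 b1 kn; rewrite coefA_alphaE//.
apply: (@ojacobi_coefE _ n a b (fun k => (-1) ^+ (n + k) * acoef n k b a)) => // x.
have H : is_derive b 1 (fun b' => ojacobi n a b' x)
    ((-1) ^+ n * (dojacobip n b a).[(- x - 1) / 2]).
  apply: is_derive_near b1 _ (is_derive_scale _ (is_derive_ojacobi n (- x) b1 a1)).
  by move=> y y1; rewrite (@ojacobi_reflect n a y)//; lra.
rewrite (is_derive_derive1 H) horner_sum mulr_sumr; apply: eq_bigr => j _.
rewrite hornerZ -ojacobiE (@ojacobi_reflect j b a) ?opprK; last by lra.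
by rewrite exprD; ring.
Qed.

Lemma integral_reflect11 (f : R -> R) :
  measurable_fun (`](-1), 1[%classic : set R) f ->
  (forall x, `](-1), 1[%classic x -> 0 <= f x) ->
  (\int[@lebesgue_measure R]_(x in `](-1)%R, 1%R[) (f (- x))%:E =
   \int[@lebesgue_measure R]_(x in `](-1)%R, 1%R[) (f x)%:E)%E.
Proof.
move=> mf f0.
set D : set R := `](-1), 1[%classic; pose g (x : R) := (f x)%:E.
have E : (-%R : R -> measurableTypeR R) @^-1` D = D.
  by rewrite /D opp_preimage_itvbndbnd opprK.
transitivity (\int[@lebesgue_measure R]_(x in (-%R : R -> measurableTypeR R) @^-1` D)
    (g \o -%R) x)%E; first by rewrite E.
rewrite -ge0_integral_pushforward//=.
- by apply: eq_measure_integral => //= A mA AS; exact: lebesgue_measureN.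
- exact: measurable_itv.
- exact/measurable_EFinP.
- by move=> x /set_mem Dx; rewrite lee_fin f0.
Qed.

(** Reflection exchanges the parameters of the weight and multiplies the polynomial by (-1)^n,
    independent of the parameters, so the squared derivative is only moved from x to - x. *)
Lemma fisher_betaE n a b : -1 < a -> -1 < b -> fisher_beta n a b = fisher_alpha n b a.
Proof.
move=> a1 b1; rewrite fisher_alpha_density// -integral_reflect11; last 2 first.
- by have /integrableP[/measurable_EFinP] := integrable_fisher_density n b1 a1.
- by move=> x /(fisher_densityE n b1 a1)[d _ <-]; exact: sqr_ge0.
congr (_ * _)%E; apply: eq_integral => x /set_mem xI; congr EFin.
have xI' : `](-1), 1[%classic (- x).
  by move/itv11P: xI => [x1 x2]; apply/itv11P; rewrite opprK.
have [d Hd <-] := fisher_densityE n b1 a1 xI'.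
have H : is_derive b 1 (fun b' : R => Num.sqrt (jacobi_weight a b' x) * ojacobi n a b' x)
    ((-1) ^+ n * d).
  apply: is_derive_near b1 _ (is_derive_scale ((-1) ^+ n) Hd) => y y1.
  rewrite (@ojacobi_reflect n a y); last by lra.
  by rewrite (jacobi_weight_reflect a y) mulrCA.
by rewrite (is_derive_derive1 H) exprMn exprAC sqrrN expr1n expr1n mul1r.
Qed.

Lemma derive1_coefA_beta n a b : -1 < a -> -1 < b ->
  derive1 (fun b' => coefA_beta n n a b') b = derive1 (fun b' => coefA_alpha n n b' a) b.
Proof.
move=> a1 b1; rewrite derive1_coefA_alpha//; apply: is_derive_derive1.
apply: is_derive_near b1 _ (is_derive_acoef_top n b1 a1) => y y1.
rewrite coefA_betaE// coefA_alphaE// /acoef ltnn addnn -mul2n exprM.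
by rewrite sqrrN expr1n expr1n mul1r.
Qed.

End reflection.

Theorem corollary2 (R : realType) (alpha beta : R)
    (halpha : -1 < alpha) (hbeta : -1 < beta) (n : nat) :
  let s := alpha + beta + 1 in
  [/\ fisher_alpha n alpha beta =
        (2 * (\sum_(k < n) coefA_alpha n k alpha beta ^+ 2)
         - 2 * derive1 (fun a : R => coefA_alpha n n a beta) alpha)%:E,
      fisher_alpha n alpha beta =
        (2 * (Gamma (n%:R + beta + 1) * n`!%:R * (2 * n%:R + s)
              / (Gamma (n%:R + alpha + 1) * Gamma (n%:R + s)))
           * (\sum_(k < n)
                Gamma (k%:R + alpha + 1) * Gamma_mul k s
                / (Gamma (k%:R + beta + 1) * k`!%:R * (n%:R - k%:R) ^+ 2
                   * (n%:R + k%:R + s) ^+ 2))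
         + (trigamma_part n s + trigamma (n%:R + alpha + 1)))%:E,
      fisher_beta n alpha beta =
        (2 * (\sum_(k < n) coefA_beta n k alpha beta ^+ 2)
         - 2 * derive1 (fun b : R => coefA_beta n n alpha b) beta)%:E
    & fisher_beta n alpha beta =
        (2 * (Gamma (n%:R + alpha + 1) * n`!%:R * (2 * n%:R + s)
              / (Gamma (n%:R + beta + 1) * Gamma (n%:R + s)))
           * (\sum_(k < n)
                Gamma (k%:R + beta + 1) * Gamma_mul k s
                / (Gamma (k%:R + alpha + 1) * k`!%:R * (n%:R - k%:R) ^+ 2
                   * (n%:R + k%:R + s) ^+ 2))
         + (trigamma_part n s + trigamma (n%:R + beta + 1)))%:E].
Proof.
move=> s; have [H1 H2] := fisher_alpha_correct n halpha hbeta.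
have [H3 H4] := fisher_alpha_correct n hbeta halpha.
rewrite [beta + alpha]addrC -/s in H4.
rewrite (fisher_betaE n halpha hbeta); split; [exact: H1|exact: H2| |exact: H4].
rewrite H3.
congr ((2 * _ - 2 * _)%:E); last by rewrite (derive1_coefA_beta n halpha hbeta).
apply: eq_bigr => k _; rewrite (coefA_betaE halpha hbeta (ltnW (ltn_ord k))).
by rewrite exprMn exprAC sqrrN expr1n expr1n mul1r.
Qed.
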